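(* Let $\pi,\tilde\pi,\beta$ be stochastic policies of a $\gamma$-discounted Markov decision process with $0\le\gamma<1$, let $Q_w$ be an arbitrary real-valued function of state-action pairs (the critic), and let $\nu\in[0,1]$. Let $\delta=\max_{s,a}|A^{\tilde\pi}(s,a)-A_w^{\tilde\pi}(s,a)|$, $\epsilon=\max_s|\bar A_w^{\pi,\tilde\pi}(s)|$, $\zeta=\max_s|\bar A^{\pi,\tilde\pi}(s)|$, and define $$\tilde J^{\beta,\nu}(\pi,\tilde\pi)=J(\tilde\pi)+(1-\nu)\,\mathbb{E}_{\rho^{\tilde\pi},\pi}[A^{\tilde\pi}(s_t,a_t)]+\nu\,\mathbb{E}_{\rho^\beta}[\bar A_w^{\pi,\tilde\pi}(s_t)],$$ $$\tilde J^{\beta,\nu,CV}(\pi,\tilde\pi)=J(\tilde\pi)+(1-\nu)\,\mathbb{E}_{\rho^{\tilde\pi},\pi}[A^{\tilde\pi}(s_t,a_t)-A_w^{\tilde\pi}(s_t,a_t)]+\mathbb{E}_{\rho^\beta}[\bar A_w^{\pi,\tilde\pi}(s_t)].$$ Then $$\left|J(\pi)-\tilde J^{\beta,\nu}(\pi,\tilde\pi)\right|\le\frac{\nu\delta}{1-\gamma}+\frac{2\gamma}{(1-\gamma)^2}\left(\nu\epsilon\sqrt{D_{KL}^{\max}(\tilde\pi,\beta)}+\zeta\sqrt{D_{KL}^{\max}(\pi,\tilde\pi)}\right)$$ and $$\left|J(\pi)-\tilde J^{\beta,\nu,CV}(\pi,\tilde\pi)\right|\le\frac{\nu\delta}{1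-\gamma}+\frac{2\gamma}{(1-\gamma)^2}\left(\epsilon\sqrt{D_{KL}^{\max}(\tilde\pi,\beta)}+\zeta\sqrt{D_{KL}^{\max}(\pi,\tilde\pi)}\right).$$
   Context: Setting: a Markov decision process with reward $r(s,a)$, transition kernel $p(s_{t+1}|s_t,a_t)$, a fixed initial state distribution $\rho_0$ (the same for all policies), and discount factor $\gamma\in[0,1)$. A (stochastic) policy $\pi$ assigns to each state $s$ a probability distribution $\pi(\cdot|s)$ over actions. All expectations, values and maxima appearing are assumed well defined and finite (a maximum is read as a supremum when not attained), except that KL divergences may be $+\infty$, with $0\cdot\infty=0$. $J(\pi)=\mathbb{E}_{s_0,a_0,\dots\sim\pi}[\sum_{t\ge0}\gamma^t r(s_t,a_t)]$. $Q^\pi(s,a)$ is the expected discounted return starting from $s$, taking action $a$, and following $\pi$ afterwards; $V^\pi(s)=\mathbb{E}_{a\sim\pi(\cdot|s)}[Q^\pi(s,a)]$; $A^\pi(s,a)=Q^\pi(s,a)-V^\pi(s)$. $\rho_t^\pi$ is the distribution of $s_t$ when $s_0\sim\rho_0$ and $\pi$ is followed, and $\rho^\pi=\sum_{t=0}^\infty\gamma^t\rho_t^\pi$ is the unnormalized discounted state visitation measure. $\mathbb{E}_{\rho^\pi}[f(s_t)]$ denotes the integral of $f$ against $\rho^\pi$, i.e. $\sum_t\gamma^t\mathbb{E}_{s\sim\rho_t^\pi}[f(s)]$; $\mathbb{E}_{\rho^{\pi'},\pi}[g(s_t,a_t)]=\mathbb{E}_{\rho^{\pi'}}\big[\mathbb{E}_{a\sim\pi(\cdot|s_t)}[g(s_t,a)]\big]$.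 $A_w^{\tilde\pi}(s,a)=Q_w(s,a)-\mathbb{E}_{a'\sim\tilde\pi(\cdot|s)}[Q_w(s,a')]$; $\bar A_w^{\pi,\tilde\pi}(s)=\mathbb{E}_{a\sim\pi(\cdot|s)}[A_w^{\tilde\pi}(s,a)]$; $\bar A^{\pi,\tilde\pi}(s)=\mathbb{E}_{a\sim\pi(\cdot|s)}[A^{\tilde\pi}(s,a)]$. $D_{KL}^{\max}(\pi_1,\pi_2)=\max_s D_{KL}(\pi_1(\cdot|s),\pi_2(\cdot|s))$, where $D_{KL}$ is the Kullback-Leibler divergence.
   Formalization: The formal theorem also assumes that the value function V of π̃ is integrable against ρ^π (automatic for bounded rewards); without it the bound can fail for unbounded rewards, even when all the expectations that appear are finite. *)

(* Defs.v *)
From HB Require Import structures.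
From mathcomp Require Import all_boot all_order all_algebra.
From mathcomp Require Import all_classical all_reals all_analysis.

Set Implicit Arguments.
Unset Strict Implicit.
Unset Printing Implicit Defensive.

Import Order.TTheory GRing.Theory Num.Theory.
Import numFieldNormedType.Exports.

Local Open Scope classical_set_scope.
Local Open Scope ring_scope.

(* State and action spaces are arbitrary measurable spaces (finite and countable
   ones are recovered with the discrete sigma-algebra), and a stochastic policy
   is a probability kernel [R.-pker S ~> A]. *)

Section kullback_leibler.
Context (dA dS : measure_display) (A : measurableType dA)
  (S : measurableType dS) (R : realType).
Local Open Scope ereal_scope.
Local Open Scope charge_scope.

Definition kl_div (P Q : probability A R) : \bar R :=
  if `[< P `<< Q >]
  then \int[P]_a lne (('d (charge_of_finite_measure P) '/d Q) a)
  else +oo.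

(* [k x] seen as a term of type [probability A R]. *)
Definition ker_at (k : R.-pker S ~> A) (x : S) : set A -> \bar R := k x.

HB.instance Definition _ (k : R.-pker S ~> A) (x : S) :=
  Measure.on (ker_at k x).

HB.instance Definition _ (k : R.-pker S ~> A) (x : S) :=
  Measure_isProbability.Build _ _ _ (ker_at k x) (prob_kernel (s := k) x).

Definition kl_max (pi1 pi2 : R.-pker S ~> A) : \bar R :=
  ereal_sup (range (fun x => kl_div (ker_at pi1 x) (ker_at pi2 x))).

End kullback_leibler.

Record mdp (R : realType) (dS dA : measure_display)
    (S : measurableType dS) (A : measurableType dA) := Mdp {
  reward : S -> A -> R ;
  measurable_reward : measurable_fun setT (fun z : S * A => reward z.1 z.2) ;
  trans : R.-pker (S * A)%type ~> S ;
  init : probability S R ;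
  disc : R ;
  disc_ge0 : 0 <= disc ;
  disc_lt1 : disc < 1 }.

Section trajectories.
Context (R : realType) (dS dA : measure_display)
  (S : measurableType dS) (A : measurableType dA) (M : mdp R S A).
Context (dO : measure_display) (Omega : measurableType dO).
Variables (st : nat -> {mfun Omega >-> S}) (act : nat -> {mfun Omega >-> A}).

(* Histories (s_0, a_0, ..., s_(n-1), a_(n-1)) lying in the measurable
   rectangle prod_(i < n) (B i x C i). *)
Definition history (n : nat) (B : nat -> set S) (C : nat -> set A) :
    set Omega :=
  [set w | forall i, (i < n)%N -> B i (st i w) /\ C i (act i w)].

(* Under P, the conditional law of s_(n+1) given (s_0, a_0, ..., s_n, a_n) is
   p(. | s_n, a_n). *)
Definition states_follow (P : probability Omega R) : Prop :=
  forall (n : nat) (B : nat -> set S) (C : nat -> set A) (D : set S),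
    (forall i, measurable (B i)) -> (forall i, measurable (C i)) ->
    measurable D ->
    P (history n.+1 B C `&` st n.+1 @^-1` D) =
    (\int[P]_(w in history n.+1 B C) trans M (st n w, act n w) D)%E.

(* Under P, for every n >= k, the conditional law of a_n given
   (s_0, a_0, ..., s_(n-1), a_(n-1), s_n) is mu(. | s_n). *)
Definition actions_follow (k : nat) (mu : R.-pker S ~> A)
    (P : probability Omega R) : Prop :=
  forall (n : nat) (B : nat -> set S) (C : nat -> set A)
         (D : set S) (E : set A), (k <= n)%N ->
    (forall i, measurable (B i)) -> (forall i, measurable (C i)) ->
    measurable D -> measurable E ->
    P (history n B C `&` st n @^-1` D `&` act n @^-1` E) =
    (\int[P]_(w in history n B C `&` st n @^-1` D) mu (st n w) E)%E.

Definition rollout_law (mu : R.-pker S ~> A) (P : probability Omega R) : Prop :=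
  [/\ forall B, measurable B -> P (st 0%N @^-1` B) = init M B,
      actions_follow 0 mu P & states_follow P].

(* Start from s_0 = x, take a_0 = a, and follow mu from time 1 on; the Dirac
   masses express the initial conditions without requiring singletons to be
   measurable. *)
Definition rollout_law_from (mu : R.-pker S ~> A) (x : S) (a : A)
    (P : probability Omega R) : Prop :=
  [/\ forall B, measurable B -> P (st 0%N @^-1` B) = \d_x B,
      forall C, measurable C -> P (act 0%N @^-1` C) = \d_a C,
      actions_follow 1 mu P & states_follow P].

End trajectories.

(* The underlying space of trajectories, with the law of
   (s_0, a_0, s_1, a_1, ...) induced by each policy.  The conditions determine
   these laws uniquely on the sigma-algebra generated by the trajectory, and
   such a space always exists (sequence space, by the Ionescu-Tulcea theorem). *)
Record rollout_space (R : realType) (dS dA : measure_display)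
    (S : measurableType dS) (A : measurableType dA) (M : mdp R S A) :=
    RolloutSpace {
  rs_display : measure_display ;
  rs_space : measurableType rs_display ;
  st : nat -> {mfun rs_space >-> S} ;
  act : nat -> {mfun rs_space >-> A} ;
  Pr : R.-pker S ~> A -> probability rs_space R ;
  PrQ : R.-pker S ~> A -> S -> A -> probability rs_space R ;
  PrP : forall mu, rollout_law M st act mu (Pr mu) ;
  PrQP : forall mu x a, rollout_law_from M st act mu x a (PrQ mu x a) }.

Section values.
Context (R : realType) (dS dA : measure_display)
  (S : measurableType dS) (A : measurableType dA) (M : mdp R S A).
Variable T : rollout_space M.
Implicit Types (mu pi tpi : R.-pker S ~> A) (Q : S -> A -> R).

Definition disc_return (w : rs_space T) : R :=
  limn (series (fun t => disc M ^+ t * reward M (st T t w) (act T t w))).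

(* Absolute integrability of the discounted return: it makes the series
   [disc_return] converge almost surely and its expectation finite. *)
Definition return_integrable (P : probability (rs_space T) R) : Prop :=
  (\int[P]_w \sum_(0 <= t <oo)
     (disc M ^+ t * `|reward M (st T t w) (act T t w)|)%:E < +oo)%E.

Definition J mu : R := \int[Pr T mu]_w disc_return w.

Definition Qval mu (x : S) (a : A) : R := \int[PrQ T mu x a]_w disc_return w.

Definition exp_act mu (f : S -> A -> R) (x : S) : R := \int[mu x]_a f x a.

Definition adv Q tpi (x : S) (a : A) : R := Q x a - exp_act tpi Q x.

Definition Vval mu : S -> R := exp_act mu (Qval mu).

Definition Aval mu : S -> A -> R := fun x a => Qval mu x a - Vval mu x.

Definition rho_t mu (t : nat) : probability S R :=
  distribution (Pr T mu) (st T t).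

Definition rho mu : {measure set S -> \bar R} :=
  mseries (fun t => mscale (NngNum (exprn_ge0 t (disc_ge0 M))) (rho_t mu t)) 0.

Definition exp_rho mu (f : S -> R) : R := \int[rho mu]_x f x.

(* [pi] is the sampling policy, [tpi] the policy whose advantage is taken. *)
Definition barA pi tpi : S -> R := exp_act pi (Aval tpi).

Definition barAw Qw pi tpi : S -> R := exp_act pi (adv Qw tpi).

Definition Jtilde Qw beta nu pi tpi : R :=
  J tpi + (1 - nu) * exp_rho tpi (exp_act pi (Aval tpi))
  + nu * exp_rho beta (barAw Qw pi tpi).

Definition JtildeCV Qw beta nu pi tpi : R :=
  J tpi
  + (1 - nu) *
    exp_rho tpi (exp_act pi (fun x a => Aval tpi x a - adv Qw tpi x a))
  + exp_rho beta (barAw Qw pi tpi).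

Definition critic_errors Qw tpi : set R :=
  [set `|Aval tpi z.1 z.2 - adv Qw tpi z.1 z.2| | z in [set: S * A]].

End values.

(* Main.v *)
Require Import Defs.
From HB Require Import structures.
From mathcomp Require Import all_boot all_order all_algebra.
From mathcomp Require Import all_classical all_reals all_analysis.
From mathcomp Require Import measurable_realfun giry ring lra.

Set Implicit Arguments.
Unset Strict Implicit.
Unset Printing Implicit Defensive.

Import Order.TTheory GRing.Theory Num.Theory.
Import numFieldNormedType.Exports.

Local Open Scope classical_set_scope.
Local Open Scope ring_scope.

(** By the performance difference lemma, [J pi - J tpi] is the integral of
    [barA] against [rho pi].  Hence the error of the interpolated objective is
    the sum of [nu] times the integral of [barA - barAw] against [rho tpi], at
    most [nu * delta / (1 - gamma)], and of two differences between the
    integrals of one bounded function against the visitation measures of two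
    policies.  Changing the policy one step at a time, the laws of the state at
    time [t] differ in total variation by at most [t] times the largest
    variation distance between the action laws, and
    [sum_t t gamma^t = gamma / (1 - gamma)^2].  The constant [2] of the
    statement leaves room for the inequality
    [|P - Q|_1 <= 2 sqrt (KL (P, Q))], weaker than Pinsker's. *)

(** * Integrals against mixtures of kernels *)

(** Rewards may be unbounded and the trajectory laws are specified only on rectangles, so every
    exchange of sum, integral and conditioning has to be justified. The identities along
    trajectories are first obtained for nonnegative functions, by Tonelli, and then transferred to
    signed ones through positive and negative parts whose integrals are shown to be finite. The
    factor [2 gamma / (1 - gamma)^2] is the product of [gamma / (1 - gamma)^2] and of the [2] in the
    L1 bound; the latter bound comes from the Hellinger-type inequality
    [(sqrt x - 1)^2 <= x ln x - x + 1], optimised by AM-GM. *)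

Section mixtures.
Context d d' (X : measurableType d) (Y : measurableType d') (R : realType).
Local Open Scope ereal_scope.
Variables (l : probability X R) (k : R.-pker X ~> Y).

Let kg (x : X) : giry Y R := ker_at k x.

Let mkg : measurable_fun [set: X] kg.
Proof.
by apply: measurable_giry_codensity => // B mB; exact: measurable_kernel.
Qed.

(** The hypothesis says that [m] is the bind of [l] and [k] in the Giry monad, where integration is
    iterated integration. *)
Lemma ge0_integral_mixture (m : {measure set Y -> \bar R}) (f : Y -> \bar R) :
  (forall E, measurable E -> m E = \int[l]_x k x E) ->
  measurable_fun [set: Y] f -> (forall y, 0 <= f y) ->
  \int[m]_y f y = \int[l]_x \int[k x]_y f y.
Proof.
move=> mE mf f0.
rewrite -[RHS](giry_int_bind (l : giry X R) mkg)//.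
rewrite /giry_int; apply: eq_measure_integral => A mA _.
rewrite mE//.
have := giry_int_bind (l : giry X R) mkg (h := fun y => (\1_A y)%:E).
rewrite /giry_int integral_indic// setIT => -> //; last first.
  exact/measurable_EFinP.
by apply: eq_integral => x _; rewrite integral_indic// setIT.
Qed.

(** Law of [(x, y)] for [y] drawn from [k x]; binding [l] with it gives the joint law. *)
Let kp (x : X) : giry (X * Y)%type R :=
  giry_map (measurable_pair1 x : measurable_fun [set: Y] (fun y => (x, y))) (kg x).

Let kpE x B : kp x B = k x (xsection B x).
Proof.
rewrite /kp /giry_map/= /pushforward /=; congr (k x _).
by apply/seteqP; split => y; rewrite /xsection/= inE.
Qed.

Let mkp : measurable_fun [set: X] kp.
Proof.
apply: measurable_giry_codensity => // B mB.
under eq_fun do rewrite kpE.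
have [r kr] := measure_uub k.
by apply: measurable_fun_xsection_finite_kernel => //; rewrite inE.
Qed.

Lemma ge0_integral_semidirect (m : probability (X * Y)%type R)
    (f : X * Y -> \bar R) :
  (forall D E, measurable D -> measurable E ->
    m (D `*` E) = \int[l]_(x in D) k x E) ->
  measurable_fun [set: X * Y] f -> (forall z, 0 <= f z) ->
  \int[m]_z f z = \int[l]_x \int[k x]_y f (x, y).
Proof.
move=> mE mf f0.
transitivity (giry_int (giry_bind (l : giry X R) mkp) f); last first.
  rewrite giry_int_bind//; apply: eq_integral => x _.
  by rewrite giry_int_map.
rewrite /giry_int; apply: eq_measure_integral => A mA _.
(* The hypothesis covers rectangles only; they form a pi-system generating the product
   sigma-algebra, which determines a finite measure. *)
pose G := [set C `*` D | C in @measurable _ X & D in @measurable _ Y].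
apply: (@measure_unique _ _ _ G (fun=> setT)) => //.
- by rewrite measurable_prod_measurableType.
- move=> _ _ [C mC [D mD <-]] [C' mC' [D' mD' <-]]; rewrite -setXI.
  by exists (C `&` C'); [exact: measurableI|exists (D `&` D') => //; exact: measurableI].
- by move=> _; exists setT => //; exists setT => //; rewrite setXTT.
- by rewrite bigcup_const.
- move=> _ [C mC [D mD <-]].
  transitivity (\int[l]_(x in C) k x D); first exact: mE.
  have mCD : measurable (C `*` D) by exact: measurableX.
  have := giry_int_bind (l : giry X R) mkp
    (h := fun y => (\1_(C `*` D) y)%:E).
  rewrite /giry_int integral_indic// setIT => -> //; last first.
    exact/measurable_EFinP.
  rewrite [LHS]integral_mkcond; apply: eq_integral => x _.
  rewrite integral_indic// setIT [RHS](kpE x) patchE; case: ifPn => xC.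
    by rewrite in_xsectionX.
  by rewrite notin_xsectionX// measure0.
- by move=> _; rewrite [ltLHS](probability_setT m) ltry.
Qed.

End mixtures.

Section signed.
Context d d' d3 (X : measurableType d) (Y : measurableType d')
  (Z : measurableType d3) (R : realType).
Local Open Scope ereal_scope.
Variables (l : {measure set X -> \bar R}) (m : {measure set Z -> \bar R}).
Variables (k : X -> {measure set Y -> \bar R}) (phi : X -> Y -> Z).
Hypothesis mk : forall f : Z -> \bar R, measurable_fun setT f ->
  (forall z, 0 <= f z) -> measurable_fun setT (fun x => \int[k x]_y f (phi x y)).
Hypothesis ge0_desint : forall f : Z -> \bar R, measurable_fun setT f ->
  (forall z, 0 <= f z) -> \int[m]_z f z = \int[l]_x \int[k x]_y f (phi x y).

(** Stated for an abstract family [k] and map [phi] so that it serves both the draw of an action and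
    the transition to the next state. *)
Lemma integral_disintegration (f : Z -> \bar R) : m.-integrable setT f ->
  l.-integrable setT (fun x => \int[k x]_y f (phi x y)) /\
  \int[m]_z f z = \int[l]_x \int[k x]_y f (phi x y).
Proof.
move=> fi; have mf := measurable_int _ fi.
have mfp := measurable_funepos mf; have mfn := measurable_funeneg mf.
have mkp := mk mfp (fun z => funepos_ge0 f z).
have mkn := mk mfn (fun z => funeneg_ge0 f z).
have fE x : \int[k x]_y f (phi x y) =
   \int[k x]_y f^\+ (phi x y) - \int[k x]_y f^\- (phi x y).
  rewrite [LHS]integralE; congr (_ - _); apply: eq_integral => y _;
    [by rewrite !funeposE|by rewrite !funenegE].
have ip : l.-integrable setT (fun x => \int[k x]_y f^\+ (phi x y)).
  apply/integrableP; split; first exact: mkp.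
  under eq_integral do rewrite gee0_abs ?integral_ge0//.
  by rewrite -ge0_desint//; exact: integral_funepos_lt_pinfty.
have im : l.-integrable setT (fun x => \int[k x]_y f^\- (phi x y)).
  apply/integrableP; split; first exact: mkn.
  under eq_integral do rewrite gee0_abs ?integral_ge0//.
  by rewrite -ge0_desint//; exact: integral_funeneg_lt_pinfty.
split; first by rewrite (funext fE); exact: integrableB.
under [RHS]eq_integral do rewrite fE.
by rewrite integralB// integralE !ge0_desint.
Qed.

End signed.

(** * A weak form of Pinsker's inequality *)

(** Provides a point at which a bound [|f x| <= B] yields [0 <= B]. *)
Lemma probability_inhabited d (T : measurableType d) (R : realType)
  (P : probability T R) : inhabited T.
Proof.
apply: contrapT => noT; have := probability_setT P.
rewrite (_ : setT = set0) ?measure0; last first.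
  by apply/seteqP; split => x // _; apply: noT; exists.
by move=> /eqP; rewrite eqe eq_sym oner_eq0.
Qed.

Lemma bounded_integrable d (T : measurableType d) (R : realType)
    (P : probability T R) (f : T -> R) (B : R) :
  measurable_fun setT f -> (forall x, `|f x| <= B) ->
  P.-integrable setT (EFin \o f).
Proof.
move=> mf fB; apply: measurable_bounded_integrable => //.
  by rewrite [ltLHS](probability_setT P) ltry.
exists B; split; first exact: num_real.
by move=> y By x _; exact: le_trans (fB x) (ltW By).
Qed.

Lemma norm_Rintegral_le d (T : measurableType d) (R : realType)
    (P : probability T R) (f : T -> R) (B : R) :
  measurable_fun setT f -> (forall x, `|f x| <= B) -> `|\int[P]_x f x| <= B.
Proof.
move=> mf fB; have fi : P.-integrable setT (EFin \o f).
  exact: bounded_integrable fB.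
apply: (le_trans (le_normr_Rintegral measurableT fi)).
have -> : B = \int[P]_x (cst B x).
  rewrite Rintegral_cst//.
  by rewrite [X in fine X](_ : _ = 1%E) ?mulr1//; exact: (probability_setT P).
apply: le_Rintegral => //; first exact: integrable_norm.
exact: finite_measure_integrable_cst.
Qed.

Section pinsker.
Context (R : realType).

(** With [s = sqrt x] this is [ln s >= 1 - 1/s] multiplied by [2 s^2]. Integrated, it bounds the
    squared Hellinger distance by the divergence. *)
Lemma sqr_sqrt_le_xlnx (x : R) : 0 <= x ->
  (Num.sqrt x - 1) ^+ 2 <= x * ln x - x + 1.
Proof.
rewrite le_eqVlt => /predU1P[<-|x0].
  by rewrite sqrtr0 mul0r subr0 !add0r sqrrN expr1n.
set s := Num.sqrt x; have s0 : 0 < s by rewrite sqrtr_gt0.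
have xE : x = s ^+ 2 by rewrite sqr_sqrtr// ltW.
rewrite xE lnXn// mulr2n.
have ls : 1 - s^-1 <= ln s.
  rewrite -[s in leRHS]invrK lnV ?posrE ?invr_gt0// -lerN2 opprK opprB.
  rewrite -[s^-1 in leLHS](addrNK 1) [_ - 1 + 1]addrC.
  by apply: le_ln1Dx; rewrite ltrBrDl subrr invr_gt0.
have : s ^+ 2 * (1 - s^-1) <= s ^+ 2 * ln s by rewrite ler_wpM2l// sqr_ge0.
have -> : s ^+ 2 * (1 - s^-1) = s ^+ 2 - s by field; rewrite gt_eqF.
nra.
Qed.

Lemma xlnx_ge0 (x : R) : 0 <= x -> 0 <= x * ln x - x + 1.
Proof. by move=> /sqr_sqrt_le_xlnx; apply: le_trans; exact: sqr_ge0. Qed.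

(* AM-GM applied to [(x - 1)^2 <= 2 (x + 1) (x ln x - x + 1)]; the parameter
   [c] stands in for the Cauchy-Schwarz inequality. *)
Lemma norm_sub1_le (x c : R) : 0 <= x -> 0 < c ->
  `|x - 1| <= c / 2 * (x + 1) + c^-1 * (x * ln x - x + 1).
Proof.
move=> x0 c0; have hx := sqr_sqrt_le_xlnx x0.
have h0 := xlnx_ge0 x0; move: hx h0.
set H := x * ln x - x + 1 => hx h0.
set s := Num.sqrt x in hx.
have s0 : 0 <= s by exact: sqrtr_ge0.
have xE : x = s ^+ 2 by rewrite sqr_sqrtr.
have sqr_le : (x - 1) ^+ 2 <= 2 * (x + 1) * H.
  (* Since [x - 1 = (s - 1)(s + 1)] and [(s + 1)^2 <= 2 (s^2 + 1)]. *)
  have : (x - 1) ^+ 2 <= 2 * (x + 1) * (s - 1) ^+ 2.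
    rewrite xE -subr_ge0.
    have -> : 2 * (s ^+ 2 + 1) * (s - 1) ^+ 2 - (s ^+ 2 - 1) ^+ 2 =
      ((s - 1) ^+ 2) ^+ 2 by ring.
    exact: sqr_ge0.
  move=> /le_trans; apply; rewrite ler_wpM2l// mulr_ge0//; lra.
rewrite -ler_sqr ?nnegrE ?addr_ge0 ?mulr_ge0 ?invr_ge0 ?(ltW c0)//; last lra.
rewrite real_normK ?num_real//.
apply: (le_trans sqr_le); rewrite -subr_ge0.
set y := c^-1.
have cy : c * y = 1 by rewrite /y mulfV// gt_eqF.
have -> : (c / 2 * (x + 1) + y * H) ^+ 2 - 2 * (x + 1) * H =
  (c / 2 * (x + 1) - y * H) ^+ 2 + 2 * (c * y - 1) * (x + 1) * H by field.
by rewrite cy subrr mulr0 !mul0r addr0 sqr_ge0.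
Qed.

Context d (T : measurableType d) (P Q : probability T R).
Local Open Scope ereal_scope.
Local Open Scope charge_scope.

(** Adding [1 - G], of integral zero against [Q], makes the integrand nonnegative, so the divergence
    can be handled by Tonelli even when it is infinite. *)
Lemma kl_density : P `<< Q -> exists G : T -> R,
  [/\ measurable_fun setT G, (forall x, (0 <= G x)%R),
      (forall f : T -> \bar R, (forall x, 0 <= f x) -> measurable_fun setT f ->
         \int[Q]_x (f x * (G x)%:E) = \int[P]_x f x) &
      kl_div P Q = \int[Q]_x (G x * ln (G x) - G x + 1)%:E].
Proof.
move=> PQ.
pose F := Radon_Nikodym_SigmaFinite.f P Q.
have F0 x : 0 <= F x by exact: Radon_Nikodym_SigmaFinite.f_ge0.
have Ffin x : F x \is a fin_num by exact: Radon_Nikodym_SigmaFinite.f_fin_num.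
have Fint : Q.-integrable setT F by exact: Radon_Nikodym_SigmaFinite.f_integrable.
pose G x := fine (F x); exists G.
have FG x : F x = (G x)%:E by rewrite fineK.
have mG : measurable_fun setT G.
  by apply/measurable_EFinP; apply: eq_measurable_fun (measurable_int _ Fint) => x _ /=.
have G0 x : (0 <= G x)%R by exact: fine_ge0.
have cov (f : T -> \bar R) : (forall x, 0 <= f x) -> measurable_fun setT f ->
    \int[Q]_x (f x * (G x)%:E) = \int[P]_x f x.
  move=> f0 mf; under eq_integral do rewrite -FG.
  exact: Radon_Nikodym_SigmaFinite.change_of_variables.
split => //.
have mlnG : measurable_fun setT (fun x => (ln (G x))%:E).
  by apply/measurable_EFinP; apply: measurableT_comp => //; exact: measurable_ln.
(* At a zero of [G] the extended logarithm is [-oo] while [ln] is real; the zero set has [P]-mass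
   equal to the [Q]-integral of [G] over it, hence zero. *)
have G_ae : {ae P, forall x, G x != 0%R}.
  exists [set x | G x = 0%R]; split.
  - rewrite (_ : [set x | _] = G @^-1` [set 0%R])//.
    by rewrite -[X in measurable X]setTI; exact: mG.
  - rewrite (Radon_Nikodym_SigmaFinite.f_integral PQ); last first.
      rewrite (_ : [set x | _] = G @^-1` [set 0%R])//.
      by rewrite -[X in measurable X]setTI; exact: mG.
    by apply: integral0_eq => x /= Gx; rewrite -/F FG Gx.
  - by move=> x /= /negP; rewrite negbK => /eqP.
have klE : kl_div P Q = \int[P]_x (ln (G x))%:E.
  rewrite /kl_div asboolT//.
  (* Two versions of the Radon-Nikodym derivative agree [Q]-almost everywhere, hence [P]-almost
     everywhere by absolute continuity. *)
  have ae_d : ae_eq P setT F ('d (charge_of_finite_measure P) '/d Q).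
    by apply: (null_dominates_ae_eq measurableT PQ);
      exact: ae_eq_Radon_Nikodym_SigmaFinite.
  pose D := 'd (charge_of_finite_measure P) '/d Q.
  have Dfin x : D x \is a fin_num by exact: Radon_Nikodym_fin_num.
  have mD : measurable_fun setT D.
    by apply: measurable_int; exact: Radon_Nikodym_integrable.
  have mfD : measurable_fun setT (fine \o D).
    apply/measurable_EFinP; apply: eq_measurable_fun mD => x _ /=.
    by rewrite fineK.
  have mlneD : measurable_fun setT (fun x => lne (D x)).
    rewrite (_ : (fun x => lne (D x)) = fun x =>
        if (fine (D x) <= 0)%R then -oo else (ln (fine (D x)))%:E); last first.
      by apply/funext => x /=; rewrite -{1}[D x]fineK.
    apply: measurable_fun_ifT => //; first exact: measurable_fun_ler.
    by apply/measurable_EFinP; apply: measurableT_comp => //; exact: measurable_ln.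
  apply: ae_eq_integral => //.
  case: ae_d => N1 [mN1 N10 sN1]; case: G_ae => N2 [mN2 N20 sN2].
  exists (N1 `|` N2); split; first exact: measurableU.
    by rewrite null_set_setU.
  move=> x /= nx; apply: contrapT => /not_orP[n1 n2]; apply: nx => _.
  have FD : F x = D x by apply: contrapT => n; apply/n1/sN1 => /= /(_ I).
  rewrite /= -/(D x) -FD FG lne_EFin// lt_neqAle eq_sym G0 andbT.
  by apply: contrapT => n; exact/n2/sN2.
pose L x := (ln (G x))%:E.
have mLp : measurable_fun setT L^\+ by exact: measurable_funepos.
have mLm : measurable_fun setT L^\- by exact: measurable_funeneg.
have mGE : measurable_fun setT (EFin \o G) by exact/measurable_EFinP.
(* As [- G ln G <= 1 - G], the negative part of the log-density is [P]-integrable, so the divergence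
   is never of the form [oo - oo]. *)
have Lm1 x : L^\- x * (G x)%:E <= 1.
  rewrite funenegE /L -EFinN -EFin_max -EFinM lee_fin maxr_pMl//.
  rewrite mul0r ge_max ler01 andbT mulrC mulrN.
  have := xlnx_ge0 (G0 x); have := G0 x; lra.
have Lm_fin : \int[P]_x L^\- x \is a fin_num.
  rewrite ge0_fin_numE ?integral_ge0// -cov//.
  apply: (@le_lt_trans _ _ (\int[Q]_x cst 1 x)).
    apply: ge0_le_integral => //.
    - by move=> x _; rewrite mule_ge0 ?lee_fin.
    - exact: emeasurable_funM.
  rewrite integral_cst// mul1e. by rewrite [ltLHS](probability_setT Q) ltry.
pose H x := (G x * ln (G x) - G x + 1)%:E.
have H0 x : 0 <= H x by rewrite lee_fin xlnx_ge0.
have mH : measurable_fun setT H.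
  apply/measurable_EFinP; apply: measurable_funD => //.
  apply: measurable_funB => //; apply: measurable_funM => //.
  by apply: measurableT_comp => //; exact: measurable_ln.
(* The definition of [H] rearranged with nonnegative terms on both sides, so that it can be
   integrated term by term. *)
have split_h x : H x + (G x)%:E + L^\- x * (G x)%:E =
   L^\+ x * (G x)%:E + 1.
  rewrite funenegE funeposE /L /H -EFinN -!EFin_max -!EFinM -!EFinD.
  congr EFin; have /orP[l|l] := le_total 0%R (ln (G x)).
    have -> : Num.max (ln (G x)) 0%R = ln (G x) by apply/max_idPl.
    have -> : Num.max (- ln (G x))%R 0%R = 0%R by apply/max_idPr; lra.
    lra.
  have -> : Num.max (ln (G x)) 0%R = 0%R by apply/max_idPr.
  have -> : Num.max (- ln (G x))%R 0%R = (- ln (G x))%R by apply/max_idPl; lra.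
  lra.
have : \int[Q]_x (H x + (G x)%:E + L^\- x * (G x)%:E) =
       \int[Q]_x (L^\+ x * (G x)%:E + 1).
  by apply: eq_integral => x _; exact: split_h.
rewrite ge0_integralD//; last 4 first.
- by move=> x _; rewrite adde_ge0// lee_fin.
- exact: emeasurable_funD.
- by move=> x _; rewrite mule_ge0 ?lee_fin.
- exact: emeasurable_funM.
rewrite ge0_integralD//; last by move=> x _; rewrite lee_fin.
rewrite ge0_integralD//; last 2 first.
- by move=> x _; rewrite mule_ge0 ?lee_fin.
- exact: emeasurable_funM.
have int1 (P' : probability T R) : \int[P']_x 1 = 1.
  by rewrite (integral_cst _ measurableT 1) mul1e; exact: (probability_setT P').
rewrite !cov// int1.
have -> : \int[Q]_x (G x)%:E = 1.
  transitivity (\int[Q]_x (cst 1 x * (G x)%:E)).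
    by apply: eq_integral => x _; rewrite /= mul1e.
  by rewrite cov.
move=> HL; rewrite klE integralE -/L.
have {HL} : \int[Q]_x H x + \int[P]_x L^\- x = \int[P]_x L^\+ x.
  by have := congr1 (fun z => z - 1) HL; rewrite addeAC !addeK.
by move=> <-; rewrite addeK.
Qed.

(** Integrate [f (G - 1) <= B |G - 1|] against [Q] using [norm_sub1_le]; [G + 1] has integral [2],
    which turns [c / 2] into [c]. *)
Lemma weak_pinsker (f : T -> R) (B c k : R) :
  measurable_fun setT f -> (forall x, (`|f x| <= B)%R) -> (0 < c)%R ->
  kl_div P Q <= k%:E ->
  (\int[P]_x f x <= \int[Q]_x f x + B * (c + c^-1 * k))%R.
Proof.
move=> mf fB c0 klk.
have PQ : P `<< Q.
  by apply: contrapT => nPQ; move: klk; rewrite /kl_div asboolF.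
have [G [mG G0 cov klE]] := kl_density PQ.
have [x0] := probability_inhabited P.
have B0 : (0 <= B)%R by exact: le_trans (fB x0).
have mlnG : measurable_fun setT (fun x => ln (G x)).
  by apply: measurableT_comp => //; exact: measurable_ln.
pose h x := (G x * ln (G x) - G x + 1)%R.
have h0 x : (0 <= h x)%R by exact: xlnx_ge0.
have mh : measurable_fun setT (EFin \o h).
  apply/measurable_EFinP; apply: measurable_funD => //.
  by apply: measurable_funB => //; exact: measurable_funM.
have mGE : measurable_fun setT (EFin \o G) by exact/measurable_EFinP.
(* Shifting [f] by [B] keeps every integrand nonnegative. *)
pose g x := (f x + B)%R.
have g0 x : (0 <= g x)%R.
  by have := fB x; rewrite ler_norml => /andP[? _]; rewrite /g; lra.
have gE0 x : 0 <= (g x)%:E by rewrite lee_fin.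
have mg : measurable_fun setT (EFin \o g).
  by apply/measurable_EFinP; exact: measurable_funD.
have fi (P' : probability T R) : P'.-integrable setT (EFin \o f).
  exact: bounded_integrable fB.
have Bi (P' : probability T R) : P'.-integrable setT (EFin \o cst B).
  by apply: finite_measure_integrable_cst.
have intB r (P' : probability T R) : \int[P']_x r%:E = r%:E.
  by rewrite (integral_cst _ measurableT r%:E) [X in _ * X](probability_setT P') mule1.
have gE (P' : probability T R) :
  \int[P']_x (g x)%:E = (\int[P']_x f x)%R%:E + B%:E.
  under eq_integral do rewrite /g EFinD.
  rewrite integralD//; [|exact: fi|exact: Bi].
  rewrite intB fineK//; apply: integrable_fin_num => //; exact: fi.
have GE : \int[Q]_x (G x)%:E = 1.
  transitivity (\int[Q]_x (cst 1 x * (G x)%:E)).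
    by apply: eq_integral => x _; rewrite /= mul1e.
  rewrite cov// (integral_cst _ measurableT 1) mul1e.
  exact: (probability_setT P).
(* The inequality on [f (G - 1)] after substituting [f = g - B] and moving the negative terms
   across. *)
have pw x : (g x * G x + B <=
    g x + B * G x + (B * (c / 2 * (G x + 1)) + B / c * h x))%R.
  have := norm_sub1_le (G0 x) c0; rewrite -/(h x) => nG.
  have : (f x * (G x - 1) <= B * `|G x - 1|)%R.
    by apply: (le_trans (ler_norm _)); rewrite normrM ler_wpM2r.
  have : (B * `|G x - 1| <= B * (c / 2 * (G x + 1) + c^-1 * h x))%R.
    by rewrite ler_wpM2l.
  rewrite /g; nra.
have bnd : \int[P]_x (g x)%:E + B%:E <= \int[Q]_x (g x)%:E + B%:E +
    ((B * c)%:E + (B / c)%:E * kl_div P Q).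
  have -> : \int[P]_x (g x)%:E + B%:E =
      \int[Q]_x ((g x)%:E * (G x)%:E + B%:E).
    rewrite ge0_integralD//; last 2 first.
    - by move=> x _; rewrite mule_ge0 ?lee_fin.
    - exact: emeasurable_funM.
    by rewrite intB cov.
  have -> : \int[Q]_x (g x)%:E + B%:E + ((B * c)%:E + (B / c)%:E * kl_div P Q) =
      \int[Q]_x (((g x)%:E + B%:E * (G x)%:E) +
        ((B * c / 2)%:E * ((G x)%:E + 1) + (B / c)%:E * (h x)%:E)).
    have Bc0 : (0 <= B * c / 2)%R by rewrite !mulr_ge0 ?invr_ge0// ltW.
    have Bc1 : (0 <= B / c)%R by rewrite mulr_ge0 ?invr_ge0// ltW.
    have G1 x : 0 <= (G x)%:E + 1 by rewrite adde_ge0 ?lee_fin.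
    have mG1 : measurable_fun setT (fun x => (G x)%:E + 1).
      exact: emeasurable_funD.
    rewrite ge0_integralD//; last 4 first.
    - by move=> x _; rewrite adde_ge0 ?mule_ge0 ?lee_fin.
    - by apply: emeasurable_funD => //; exact: emeasurable_funM.
    - by move=> x _; apply: adde_ge0; apply: mule_ge0 => //; exact: h0.
    - by apply: emeasurable_funD => //; exact: emeasurable_funM.
    rewrite ge0_integralD//; last 2 first.
    - by move=> x _; rewrite mule_ge0 ?lee_fin.
    - exact: emeasurable_funM.
    rewrite [in RHS]ge0_integralD//; last 4 first.
    - by move=> x _; apply: mule_ge0.
    - exact: emeasurable_funM.
    - by move=> x _; apply: mule_ge0 => //; exact: h0.
    - exact: emeasurable_funM.
    rewrite !ge0_integralZl_EFin//; last first.
    - by move=> x _; rewrite lee_fin.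
    - by move=> x _; rewrite lee_fin.
    rewrite ge0_integralD//; last by move=> x _; rewrite lee_fin.
    rewrite GE (intB 1%R) mule1 klE -/h.
    by congr (_ + (_ + _)); rewrite -EFinD -EFinM; congr EFin; field.
  apply: ge0_le_integral => //.
  - by move=> x _; rewrite adde_ge0 ?mule_ge0 ?lee_fin.
  - by apply: emeasurable_funD => //; exact: emeasurable_funM.
  - apply: emeasurable_funD.
      by apply: emeasurable_funD => //; exact: emeasurable_funM.
    apply: emeasurable_funD; apply: emeasurable_funM => //.
    exact: emeasurable_funD.
  - move=> x _; rewrite -[1%E]/(1%:E) -!(EFinM, EFinD) lee_fin.
    by have := pw x; lra.
rewrite -lee_fin EFinD.
have := bnd; rewrite !gE => {}bnd.
have c'0 : (0 <= B / c)%R by rewrite mulr_ge0 ?invr_ge0// ltW.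
have {bnd} := le_trans bnd (leeD2l _ (leeD2l _ (lee_wpmul2l _ klk))).
by rewrite lee_fin => /(_ c'0); rewrite -!EFinM -!EFinD !lee_fin; lra.
Qed.

(** The choice [c = sqrt k] minimises [c + k / c], with value [2 sqrt k]; the bound for [- f] gives
    the absolute value. *)
Lemma Rintegral_gap_le_kl (f : T -> R) (B k : R) :
  measurable_fun setT f -> (forall x, (`|f x| <= B)%R) -> (0 <= k)%R ->
  kl_div P Q <= k%:E ->
  (`|\int[P]_x f x - \int[Q]_x f x| <= B * (2 * Num.sqrt k))%R.
Proof.
move=> mf fB k0 klk.
have [x0] := probability_inhabited P.
have B0 : (0 <= B)%R by exact: le_trans (fB x0).
have fi (P' : probability T R) : P'.-integrable setT (EFin \o f).
  exact: bounded_integrable fB.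
have gap c : (0 < c)%R ->
    (`|\int[P]_x f x - \int[Q]_x f x| <= B * (c + c^-1 * k))%R.
  move=> c0; have le1 := weak_pinsker mf fB c0 klk.
  have mNf : measurable_fun setT (fun x => (-1 * f x)%R).
    exact: measurable_funM.
  have NfB x : (`|-1 * f x| <= B)%R by rewrite mulN1r normrN.
  have := weak_pinsker mNf NfB c0 klk.
  rewrite (RintegralZl _ measurableT (fi P)) (RintegralZl _ measurableT (fi Q)).
  move=> le2.
  rewrite ler_norml; lra.
(* For [k = 0] the infimum over [c > 0] is not attained, so [c] tends to [0]; the denominator
   [B + 1] covers [B = 0]. *)
move: k0; rewrite le_eqVlt => /predU1P[k0|k0].
  rewrite -k0 sqrtr0 mulr0 mulr0; apply/ler_addgt0Pr => e e0; rewrite add0r.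
  have c0 : (0 < e / (B + 1))%R by rewrite divr_gt0// ltr_wpDl.
  apply: (le_trans (gap _ c0)); rewrite -k0 mulr0 addr0 mulrA.
  rewrite ler_pdivrMr ?ltr_wpDl//; nra.
have c0 : (0 < Num.sqrt k)%R by rewrite sqrtr_gt0.
apply: (le_trans (gap _ c0)); rewrite le_eqVlt; apply/predU1P; left.
set s := Num.sqrt k in c0 *.
have kE : k = (s * s)%R by rewrite -expr2 sqr_sqrtr// ltW.
have -> : (s^-1 * k = s)%R by rewrite [in LHS]kE mulKf// gt_eqF.
by rewrite mulr_natl mulr2n.
Qed.

End pinsker.

(** * Trajectories *)

(** Where the sequence diverges, [limn] takes the default value [0]. It is therefore the limit
    superior times the indicator of the measurable set where the limits superior and inferior are
    finite and equal. *)
Lemma measurable_limn d (T : measurableType d) (R : realType)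
    (u : (T -> R)^nat) : (forall n, measurable_fun setT (u n)) ->
  measurable_fun setT (fun w => limn (u ^~ w)).
Proof.
move=> mu.
pose v n w := (u n w)%:E.
have mv n : measurable_fun setT (v n) by exact/measurable_EFinP.
pose s w := limn_esup (v ^~ w); pose i w := limn_einf (v ^~ w).
have ms : measurable_fun setT s by exact: measurable_fun_limn_esup.
have mi : measurable_fun setT i.
  rewrite (_ : i = fun w => (- limn_esup (fun n => - v n w))%E); last first.
    by apply/funext => w; rewrite [X in (- X)%E](limn_esupN (v ^~ w)) oppeK.
  apply: measurableT_comp => //.
  by apply: measurable_fun_limn_esup => n; exact: measurableT_comp.
have mfs : measurable_fun setT (fine \o s).
  by apply: measurableT_comp => //; exact: fine_measurable.
have mfi : measurable_fun setT (fine \o i).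
  by apply: measurableT_comp => //; exact: fine_measurable.
pose E := [set w | s w \is a fin_num] `&` [set w | i w \is a fin_num] `&`
  [set w | fine (s w) == fine (i w)].
have mE : measurable E.
  apply: measurableI; first apply: measurableI.
  - by rewrite -[X in measurable X]setTI; exact: emeasurable_fin_num.
  - by rewrite -[X in measurable X]setTI; exact: emeasurable_fin_num.
  - rewrite (_ : [set w | _] = (fun w => fine (s w) - fine (i w)) @^-1` [set 0]).
      rewrite -[X in measurable X]setTI.
      by apply: measurable_funB => //; exact: measurable_set1.
    apply/seteqP; split => w /=; first by move/eqP ->; rewrite subrr.
    by move/eqP; rewrite subr_eq0.
rewrite (_ : (fun w => _) = fun w => fine (s w) * \1_E w); last first.
  apply/funext => w; rewrite indicE; have [wE|wE] := boolP (w \in E).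
    rewrite mulr1; move: wE; rewrite inE => -[[/= sf fi] /eqP si].
    apply/cvg_lim => //.
    have /fine_cvgP[_] : v ^~ w @ \oo --> (fine (s w))%:E; last exact.
    apply: (@squeeze_cvge _ _ _ _ (einfs (v ^~ w)) _ (esups (v ^~ w))).
    - apply: nearW => n; apply/andP; split.
        by apply: ereal_inf_lbound; exists n => /=.
      by apply: ereal_sup_ubound; exists n => /=.
    - rewrite si fineK// /i limn_einf_lim; exact: is_cvg_einfs.
    - rewrite fineK// /s limn_esup_lim; exact: is_cvg_esups.
  rewrite mulr0; apply: dvgP => /cvg_ex[/= l ul]; move: wE => /negP; apply.
  have vl : v ^~ w @ \oo --> l%:E.
    by apply/fine_cvgP; split; [exact: nearW|exact: ul].
  have [il sl] := cvg_limn_einf_sup vl.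
  by rewrite inE /E /= /s /i il sl.
by apply: measurable_funM => //; exact: measurable_indic.
Qed.

(** * One-step conditional laws along a trajectory *)

Section onestep.
Context (R : realType) (dS dA : measure_display)
  (S : measurableType dS) (A : measurableType dA) (M : mdp R S A).
Context (dO : measure_display) (Omega : measurableType dO).
Variables (st : nat -> {mfun Omega >-> S}) (act : nat -> {mfun Omega >-> A}).
Variables (P : probability Omega R) (mu : R.-pker S ~> A) (k : nat).
Hypothesis afP : actions_follow st act k mu P.
Hypothesis sfP : states_follow M st act P.
Local Open Scope ereal_scope.

Definition sa_pair n w := (st n w, act n w).

Lemma measurable_sa n : measurable_fun setT (sa_pair n).
Proof. exact: measurable_fun_pair. Qed.

Definition sa_mfun n : {mfun Omega >-> (S * A)%type} :=
  HB.pack (sa_pair n) (isMeasurableFun.Build _ _ _ _ (sa_pair n) (@measurable_sa n)).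

(* Only one-step marginals of the trajectory law are needed, so the histories
   in [actions_follow] and [states_follow] are taken unconstrained. *)
Lemma historyT n : history st act n (fun=> setT) (fun=> setT) = setT.
Proof. by apply/seteqP; split. Qed.

(** The law of the pair at time [n] is the semidirect product of the law of [st n] and [mu]. The
    bound [k <= n] excludes an imposed first action. *)
Lemma ge0_integral_sa n f : (k <= n)%N ->
  measurable_fun setT f -> (forall z, 0 <= f z) ->
  \int[P]_w f (sa_pair n w) = \int[P]_w \int[mu (st n w)]_a f (st n w, a).
Proof.
move=> kn mf f0.
transitivity (\int[distribution P (sa_mfun n)]_z f z).
  by rewrite ge0_integral_distribution.
rewrite (@ge0_integral_semidirect _ _ _ _ _ (distribution P (st n)) mu)//.
  rewrite ge0_integral_distribution//.
    exact: measurable_fun_integral_finite_kernel.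
  by move=> x; exact: integral_ge0.
move=> D E mD mE.
have := afP kn (fun=> measurableT) (fun=> measurableT) mD mE.
rewrite historyT !setTI => PE.
transitivity (P (st n @^-1` D `&` act n @^-1` E)) => //.
rewrite PE; apply/esym/ge0_integral_pushforward => //.
exact/measurable_funTS/measurable_kernel.
Qed.

Lemma ge0_integral_st n g : 
  measurable_fun setT g -> (forall z, 0 <= g z) ->
  \int[P]_w g (st n.+1 w) = \int[P]_w \int[trans M (sa_pair n w)]_s g s.
Proof.
move=> mg g0.
transitivity (\int[distribution P (st n.+1)]_z g z).
  by rewrite ge0_integral_distribution.
rewrite (@ge0_integral_mixture _ _ _ _ _ (distribution P (sa_mfun n)) (trans M))//.
  rewrite ge0_integral_distribution//.
    by apply: measurable_fun_integral_kernel => // U mU; exact: measurable_kernel.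
  by move=> x; exact: integral_ge0.
move=> E mE; transitivity (P (st n.+1 @^-1` E)) => //.
have := sfP n (fun=> measurableT) (fun=> measurableT) mE.
rewrite historyT !setTI => ->.
by rewrite ge0_integral_distribution//; exact: measurable_kernel.
Qed.

Lemma integral_sa n f : (k <= n)%N -> measurable_fun setT f ->
  P.-integrable setT (f \o sa_pair n) ->
  P.-integrable setT (fun w => \int[mu (st n w)]_a f (st n w, a)) /\
  \int[P]_w f (sa_pair n w) = \int[P]_w \int[mu (st n w)]_a f (st n w, a).
Proof.
move=> kn mf fi.
have fd : (distribution P (sa_mfun n)).-integrable setT f.
  exact: integrable_pushforward.
have [||fi1 fE] := @integral_disintegration _ _ _ _ _ _ _ P
  (distribution P (sa_mfun n)) (fun w => mu (st n w)) (fun w a => (st n w, a))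
  _ _ f fd.
- move=> g mg g0.
  have mF : measurable_fun setT (fun x => \int[mu x]_a g (x, a)).
    exact: measurable_fun_integral_finite_kernel.
  exact: measurableT_comp mF _.
- by move=> g mg g0; rewrite -ge0_integral_sa// ge0_integral_distribution.
split => //; rewrite -fE integral_distribution//.
Qed.

Lemma integral_st n g : measurable_fun setT g ->
  P.-integrable setT (g \o st n.+1) ->
  P.-integrable setT (fun w => \int[trans M (sa_pair n w)]_s g s) /\
  \int[P]_w g (st n.+1 w) = \int[P]_w \int[trans M (sa_pair n w)]_s g s.
Proof.
move=> mg gi.
have gd : (distribution P (st n.+1)).-integrable setT g.
  exact: integrable_pushforward.
have [||gi1 gE] := @integral_disintegration _ _ _ _ _ _ _ P
  (distribution P (st n.+1)) (fun w => trans M (sa_pair n w)) (fun _ s => s)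
  _ _ g gd.
- move=> h mh h0.
  apply: measurable_fun_integral_kernel => // U mU.
  exact: measurableT_comp (measurable_kernel (trans M) _ mU) (measurable_sa n).
- by move=> h mh h0; rewrite -ge0_integral_st// ge0_integral_distribution.
by split => //; rewrite -gE integral_distribution.
Qed.

End onestep.

(** * The transition operator on state-action pairs *)

Section operators.
Context (R : realType) (dS dA : measure_display)
  (S : measurableType dS) (A : measurableType dA) (M : mdp R S A)
  (mu : R.-pker S ~> A).
Local Open Scope ereal_scope.

Definition exp_next (f : S -> R) (z : S * A) : R := (\int[trans M z]_s f s)%R.

(** Transition operator of the Markov chain of state-action pairs under [mu]; with values in
    [\bar R] its iterates on nonnegative functions always make sense. *)
Definition next_sa (f : S * A -> \bar R) (z : S * A) : \bar R :=
  \int[trans M z]_s \int[mu s]_a f (s, a).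

Lemma next_sa_ge0 f : (forall z, 0 <= f z) -> forall z, 0 <= next_sa f z.
Proof. by move=> f0 z; apply: integral_ge0 => s _; exact: integral_ge0. Qed.

Lemma measurable_next_sa f : (forall z, 0 <= f z) -> measurable_fun setT f ->
  measurable_fun setT (next_sa f).
Proof.
move=> f0 mf; apply: measurable_fun_integral_kernel.
- by move=> U mU; exact: measurable_kernel.
- by move=> s; exact: integral_ge0.
- exact: measurable_fun_integral_finite_kernel.
Qed.

Lemma iter_next_sa_ge0 t f : (forall z, 0 <= f z) ->
  forall z, 0 <= iter t next_sa f z.
Proof. by move=> f0; elim: t => //= t ih; exact: next_sa_ge0. Qed.

Lemma measurable_iter_next_sa t f : (forall z, 0 <= f z) ->
  measurable_fun setT f -> measurable_fun setT (iter t next_sa f).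
Proof.
move=> f0 mf; elim: t => //= t ih; apply: measurable_next_sa => //.
exact: iter_next_sa_ge0.
Qed.

(** The resolvent of the chain: for a nonnegative reward [f] it is the action value of [mu]. *)
Definition disc_sum (f : S * A -> \bar R) (z : S * A) : \bar R :=
  \sum_(t <oo) (disc M ^+ t)%:E * iter t next_sa f z.

Lemma disc_sum_term_ge0 t f z : (forall z, 0 <= f z) ->
  0 <= (disc M ^+ t)%:E * iter t next_sa f z.
Proof.
by move=> f0; rewrite mule_ge0 ?iter_next_sa_ge0// lee_fin exprn_ge0 ?disc_ge0.
Qed.

Lemma disc_sum_ge0 f : (forall z, 0 <= f z) -> forall z, 0 <= disc_sum f z.
Proof. by move=> f0 z; apply: nneseries_ge0 => t _ _; exact: disc_sum_term_ge0. Qed.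

Lemma measurable_disc_sum f : (forall z, 0 <= f z) -> measurable_fun setT f ->
  measurable_fun setT (disc_sum f).
Proof.
move=> f0 mf; apply: ge0_emeasurable_sum => t.
  by move=> z _ _; exact: disc_sum_term_ge0.
by move=> _; apply: emeasurable_funM => //; exact: measurable_iter_next_sa.
Qed.

Context (dO : measure_display) (Omega : measurableType dO).
Variables (st : nat -> {mfun Omega >-> S}) (act : nat -> {mfun Omega >-> A}).
Variable P : probability Omega R.
Local Notation sa := (sa_pair st act).

(** Iterating from time [n] draws actions only from time [n.+1] on. Hence [k <= n.+1], which allows
    [k = 1] and [n = 0], the case of an imposed first action. *)
Lemma ge0_integral_iter k n t f :
  actions_follow st act k mu P -> states_follow M st act P -> (k <= n.+1)%N ->
  (forall z, 0 <= f z) -> measurable_fun setT f ->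
  \int[P]_w iter t next_sa f (sa n w) = \int[P]_w f (sa (n + t)%N w).
Proof.
move=> af sf + f0 mf; elim: t n => [|t ih] n kn; first by rewrite addn0.
have m_it := measurable_iter_next_sa t f0 mf.
have it0 := iter_next_sa_ge0 t f0.
rewrite addnS -addSn -ih; last exact: leqW.
rewrite [RHS](ge0_integral_sa af)//.
have mF : measurable_fun setT (fun s => \int[mu s]_a iter t next_sa f (s, a)).
  exact: measurable_fun_integral_finite_kernel.
apply: esym; apply: (ge0_integral_st sf _ mF) => s.
exact: integral_ge0.
Qed.

Lemma integral_disc_sum k n f :
  actions_follow st act k mu P -> states_follow M st act P -> (k <= n.+1)%N ->
  (forall z, 0 <= f z) -> measurable_fun setT f ->
  \int[P]_w disc_sum f (sa n w) =
  \sum_(t <oo) (disc M ^+ t)%:E * \int[P]_w f (sa (n + t)%N w).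
Proof.
move=> af sf kn f0 mf; rewrite integral_nneseries//; last 2 first.
- move=> t; apply: emeasurable_funM => //.
  by apply: measurableT_comp (measurable_sa st act n); exact: measurable_iter_next_sa.
- by move=> t w _; exact: disc_sum_term_ge0.
apply: eq_eseriesr => t _; rewrite ge0_integralZl//.
- by rewrite (@ge0_integral_iter k n t f).
- by apply: measurableT_comp (measurable_sa st act n); exact: measurable_iter_next_sa.
- by move=> w _; exact: iter_next_sa_ge0.
- by rewrite lee_fin exprn_ge0 ?disc_ge0.
Qed.

(** Only the two marginals at time 0 are given, but Dirac marginals force the joint law:
    intersecting with an event of probability 0 or 1 is determined. *)
Lemma integral_sa0_from x a f : rollout_law_from M st act mu x a P ->
  (forall z, 0 <= f z) -> measurable_fun setT f ->
  \int[P]_w f (sa 0 w) = f (x, a).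
Proof.
move=> [P0 Pa _ _] f0 mf.
transitivity (\int[distribution P (sa_mfun st act 0)]_z f z).
  by rewrite ge0_integral_distribution.
(* The constant kernel at [a] presents the Dirac mass at [(x, a)] as a semidirect product. *)
pose ka : R.-pker S ~> A := kdirac (@measurable_cst _ _ S A setT a).
rewrite (@ge0_integral_semidirect _ _ _ _ _ (dirac x) ka)//.
  rewrite integral_dirac//; last exact: measurable_fun_integral_finite_kernel.
  rewrite diracT mul1e /ka /= /kdirac integral_dirac ?diracT ?mul1e//.
  exact: measurableT_comp.
move=> D E mD mE.
transitivity (P (st 0%N @^-1` D `&` act 0%N @^-1` E)) => //.
rewrite integral_mkcond integral_dirac//; last first.
  apply/(measurable_restrictT _ mD)/measurable_funTS.
  exact: measurable_kernel.
rewrite diracT mul1e patchE /ka/= /kdirac.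
have mD' : measurable (st 0%N @^-1` D) by rewrite -[X in measurable X]setTI; exact: measurable_funP.
have mE' : measurable (act 0%N @^-1` E) by rewrite -[X in measurable X]setTI; exact: measurable_funP.
case: ifPn => xD; last first.
  apply/eqP; rewrite -measure_le0 -(_ : P (st 0%N @^-1` D) = 0).
    by apply: le_measure => //; rewrite inE//; exact: measurableI.
  by rewrite P0// diracE (negbTE xD).
have PD : P (st 0%N @^-1` D) = 1 by rewrite P0// diracE xD.
rewrite -[RHS]Pa// [RHS](measureDI P mE' mD') setIC.
rewrite -[LHS]add0e; congr (_ + _); apply/esym/eqP.
rewrite -measure_le0 -(_ : P (~` (st 0%N @^-1` D)) = 0).
  apply: le_measure; rewrite ?inE;
    [exact: measurableD|exact: measurableC|by move=> w []].
by rewrite probability_setC// PD subee.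
Qed.

End operators.

(** * Series of random variables *)

Section random_series.
Context d (T : measurableType d) (R : realType) (P : {measure set T -> \bar R}).
Variable X : nat -> T -> R.
Hypothesis mX : forall n, measurable_fun setT (X n).
Hypothesis iX : (\int[P]_w \sum_(t <oo) `|X t w|%:E < +oo)%E.

Local Notation Xp t := ((EFin \o X t)^\+)%E.
Local Notation Xm t := ((EFin \o X t)^\-)%E.

Let mXE n : measurable_fun setT (EFin \o X n).
Proof. exact/measurable_EFinP. Qed.

Let mabs n : measurable_fun setT (fun w => `|X n w|%:E).
Proof. by apply/measurable_EFinP; exact: measurableT_comp. Qed.

Let iX' : (\sum_(t <oo) \int[P]_w `|X t w|%:E < +oo)%E.
Proof. by rewrite -integral_nneseries// => n x _; rewrite lee_fin. Qed.

Lemma integrable_term n : P.-integrable setT (EFin \o X n).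
Proof.
apply/integrableP; split => //.
apply: le_lt_trans iX'; apply: le_trans (nneseries_lim_ge n.+1 _); last first.
  by move=> t _ _; apply: integral_ge0 => w _; rewrite lee_fin.
rewrite big_nat_recr//= leeDr// sume_ge0// => t _.
by apply: integral_ge0 => w _; rewrite lee_fin.
Qed.

(** Dominated convergence: the sum [g] of the absolute values dominates the partial sums, and its
    finite integral gives absolute convergence almost everywhere. *)
Lemma cvg_Rintegral_series :
  P.-integrable setT (fun w => (limn (series (X ^~ w)))%:E) /\
  (series (fun t => \int[P]_w X t w) @ \oo --> \int[P]_w limn (series (X ^~ w))).
Proof.
have mser n : measurable_fun setT (fun w => series (X ^~ w) n).
  rewrite /series /=. exact: measurable_sum.
pose g w := (\sum_(t <oo) `|X t w|%:E)%E.
have g0 w : (0 <= g w)%E by apply: nneseries_ge0 => t _ _; rewrite lee_fin.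
have mg : measurable_fun setT g.
  by apply: ge0_emeasurable_sum => // t w _ _; rewrite lee_fin.
have gi : P.-integrable setT g.
  apply/integrableP; split => //.
  by under eq_integral do rewrite gee0_abs//.
have mlim : measurable_fun setT (fun w => (limn (series (X ^~ w)))%:E).
  apply/measurable_EFinP; exact: (measurable_limn mser).
have [|||fi _ fcvg] := @dominated_convergence _ _ _ P setT measurableT
  (fun n w => (series (X ^~ w) n)%:E) (fun w => (limn (series (X ^~ w)))%:E) g
  _ mlim _ gi _.
- by move=> n; exact/measurable_EFinP.
- have [N [mN N0 sN]] := integrable_ae measurableT gi.
  exists N; split => // w /= nw; apply: sN => /= /(_ I) gfin; apply: nw => _.
  have cw : cvgn (series (X ^~ w)).
    have gw : (g w < +oo)%E by rewrite ltey_eq gfin.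
    by apply: normed_cvg; exact: (nnseries_is_cvg _ gw).
  by apply/fine_cvgP; split; [exact: nearW|exact: cw].
- apply: aeW => w n _; apply: le_trans (nneseries_lim_ge n _); last first.
    by move=> t _ _; rewrite lee_fin.
  by rewrite sumEFin lee_fin; exact: ler_norm_sum.
split => //.
have -> : series (fun t => \int[P]_w X t w) =
    fine \o (fun n => \int[P]_w (series (X ^~ w) n)%:E)%E.
  apply/funext => n /=; rewrite /series /=.
  under [in RHS]eq_integral do rewrite -sumEFin.
  rewrite integral_sum//; last by move=> t; exact: (integrable_term t).
  rewrite -sum_fine//= => t _; apply: integrable_fin_num => //.
  exact: (integrable_term t).
apply: fine_cvg; rewrite fineK//.
exact: integrable_fin_num fi.
Qed.

Lemma nneseries_le_fin_num (f g : nat -> \bar R) :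
  (forall t, 0 <= f t)%E -> (forall t, f t <= g t)%E ->
  (\sum_(t <oo) g t < +oo -> \sum_(t <oo) f t \is a fin_num)%E.
Proof.
move=> f0 fg goo; rewrite ge0_fin_numE; last by apply: nneseries_ge0.
by apply: le_lt_trans goo; apply: lee_nneseries.
Qed.

(** Separating the signs produces nonnegative series, on which the transition operator can act
    without integrability conditions. *)
Lemma Rintegral_limn_series :
  [/\ (\sum_(t <oo) \int[P]_w Xp t w)%E \is a fin_num,
      (\sum_(t <oo) \int[P]_w Xm t w)%E \is a fin_num &
      (\int[P]_w limn (series (X ^~ w)))%:E =
      (\sum_(t <oo) \int[P]_w Xp t w -
       \sum_(t <oo) \int[P]_w Xm t w)%E].
Proof.
have mp t : measurable_fun setT (Xp t) by exact: measurable_funepos.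
have mm t : measurable_fun setT (Xm t) by exact: measurable_funeneg.
have p0 t : (0 <= \int[P]_w Xp t w)%E by apply: integral_ge0.
have m0 t : (0 <= \int[P]_w Xm t w)%E by apply: integral_ge0.
have absE t w : (`|X t w|%:E = Xp t w + Xm t w)%E.
  exact: (congr1 (@^~ w) (fune_abse (EFin \o X t))).
have pfin : (\sum_(t <oo) \int[P]_w Xp t w)%E \is a fin_num.
  apply: nneseries_le_fin_num iX' => // t.
  by apply: ge0_le_integral => // w _; rewrite absE leeDl.
have mfin : (\sum_(t <oo) \int[P]_w Xm t w)%E \is a fin_num.
  apply: nneseries_le_fin_num iX' => // t.
  by apply: ge0_le_integral => // w _; rewrite absE leeDr.
split => //.
have [_ cX] := cvg_Rintegral_series.
have pt t : (\int[P]_w Xp t w)%E \is a fin_num.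
  exact: integrable_pos_fin_num (integrable_term t).
have mt t : (\int[P]_w Xm t w)%E \is a fin_num.
  exact: integrable_neg_fin_num (integrable_term t).
have serE : EFin \o series (fun t => \int[P]_w X t w) =
  (fun n => \sum_(0 <= t < n) \int[P]_w Xp t w -
            \sum_(0 <= t < n) \int[P]_w Xm t w)%E.
  apply/funext => n /=; rewrite /series/= -sumEFin.
  rewrite (eq_bigr (fun t => \int[P]_w Xp t w -
    \int[P]_w Xm t w)%E); last first.
    move=> t _; rewrite fineK; first exact: integralE.
    by apply: integrable_fin_num => //; exact: (integrable_term t).
  by rewrite big_split/=; congr (_ + _)%E; rewrite fin_num_sumeN.
have c1 : EFin \o series (fun t => \int[P]_w X t w) @ \oo -->
    (\int[P]_w limn (series (X ^~ w)))%:E.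
  by apply/fine_cvgP; split; [exact: nearW|exact: cX].
have c2 : EFin \o series (fun t => \int[P]_w X t w) @ \oo -->
  (\sum_(t <oo) \int[P]_w Xp t w -
       \sum_(t <oo) \int[P]_w Xm t w)%E.
  rewrite serE; apply: cvgeB.
  - by rewrite fin_num_adde_defr.
  - exact: is_cvg_nneseries.
  - exact: is_cvg_nneseries.
exact: cvg_unique c1 c2.
Qed.

End random_series.

(** * The critic *)

Lemma nneseriesS (R : realType) (u : nat -> \bar R) : (forall t, 0 <= u t)%E ->
  (\sum_(t <oo) u t = u 0%N + \sum_(t <oo) u t.+1)%E.
Proof.
move=> u0; apply/cvg_lim => //; rewrite -cvg_shiftS /=.
under eq_fun do rewrite big_nat_recl//=.
apply: cvgeD; [|exact: cvg_cst|exact: is_cvg_nneseries].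
by rewrite ge0_adde_def// inE// nneseries_ge0.
Qed.

Section performance_difference.
Context (R : realType) (dS dA : measure_display)
  (S : measurableType dS) (A : measurableType dA) (M : mdp R S A).
Variable T : rollout_space M.
Local Open Scope ereal_scope.

Local Notation gamma := (disc M).
Local Notation sa := (sa_pair (st T) (act T)).

Definition rewardE (z : S * A) : \bar R := (reward M z.1 z.2)%:E.

Lemma measurable_rewardE : measurable_fun setT rewardE.
Proof. by apply/measurable_EFinP; exact: measurable_reward. Qed.

Let gX_ge0 t : (0 <= gamma ^+ t)%R.
Proof. by rewrite exprn_ge0 ?disc_ge0. Qed.

Let m_comp_sa (f : S * A -> \bar R) n : measurable_fun setT f ->
  measurable_fun setT (fun w => f (sa n w)).
Proof. by move=> mf; apply: measurableT_comp (measurable_sa _ _ n). Qed.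

(** Only rewards from time [n] on count, and the discount restarts at [gamma ^+ 0], as in a return
    observed from time [n]. *)
Definition ret_pos (P : probability (rs_space T) R) n : \bar R :=
  \sum_(t <oo) (gamma ^+ t)%:E * \int[P]_w rewardE^\+ (sa (n + t)%N w).
Definition ret_neg (P : probability (rs_space T) R) n : \bar R :=
  \sum_(t <oo) (gamma ^+ t)%:E * \int[P]_w rewardE^\- (sa (n + t)%N w).

Let X t (w : rs_space T) : R := (gamma ^+ t * reward M (st T t w) (act T t w))%R.

Let mX t : measurable_fun setT (X t).
Proof.
apply/measurable_EFinP.
rewrite (_ : EFin \o X t = fun w => (gamma ^+ t)%:E * rewardE (sa t w))//.
by apply: emeasurable_funM => //; exact: (m_comp_sa t measurable_rewardE).
Qed.

Let iX P : return_integrable P -> \int[P]_w \sum_(t <oo) `|X t w|%:E < +oo.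
Proof.
rewrite /return_integrable; congr (_ < _); apply: eq_integral => w _.
apply: eq_eseriesr => t _.
by rewrite /X normrM ger0_norm.
Qed.

Lemma integrable_reward_term P t : return_integrable P ->
  P.-integrable setT (fun w => (gamma ^+ t)%:E * rewardE (sa t w)).
Proof. by move=> /iX iP; exact: (integrable_term mX iP t). Qed.

Lemma cvg_disc_return P : return_integrable P ->
  (series (fun t => \int[P]_w (gamma ^+ t * reward M (st T t w) (act T t w)))
    @ \oo --> \int[P]_w disc_return w)%R.
Proof. by move=> /iX iP; have [_] := cvg_Rintegral_series mX iP. Qed.

Lemma Rintegral_disc_return P : return_integrable P ->
  [/\ ret_pos P 0 \is a fin_num, ret_neg P 0 \is a fin_num &
      (\int[P]_w disc_return w)%R%:E = ret_pos P 0 - ret_neg P 0].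
Proof.
move=> /iX iP; have := Rintegral_limn_series mX iP.
rewrite (_ : \sum_(t <oo) \int[P]_w (EFin \o X t)^\+ w = ret_pos P 0); last first.
  apply: eq_eseriesr => t _; rewrite add0n -ge0_integralZl ?lee_fin//; last first.
    by apply: m_comp_sa; apply: measurable_funepos; exact: measurable_rewardE.
  apply: eq_integral => w _.
  rewrite !funeposE -[(EFin \o X t) w]/((gamma ^+ t)%:E * rewardE (sa t w)).
  by rewrite maxe_pMr ?lee_fin// mule0.
rewrite (_ : \sum_(t <oo) \int[P]_w (EFin \o X t)^\- w = ret_neg P 0)//.
apply: eq_eseriesr => t _; rewrite add0n -ge0_integralZl ?lee_fin//; last first.
  by apply: m_comp_sa; apply: measurable_funeneg; exact: measurable_rewardE.
apply: eq_integral => w _.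
rewrite !funenegE -[(EFin \o X t) w]/((gamma ^+ t)%:E * rewardE (sa t w)).
by rewrite -muleN maxe_pMr ?lee_fin// mule0.
Qed.

Section critic.
Variable tpi : R.-pker S ~> A.
Hypothesis Q_tpi : forall x a, return_integrable (PrQ T tpi x a).

Local Notation Q := (Qval T tpi).
Local Notation V := (Vval T tpi).
Local Notation dsum := (disc_sum M tpi).

Definition QE (z : S * A) : \bar R := (Q z.1 z.2)%:E.

Let mpos : measurable_fun setT rewardE^\+.
Proof. by apply: measurable_funepos; exact: measurable_rewardE. Qed.

Let mneg : measurable_fun setT rewardE^\-.
Proof. by apply: measurable_funeneg; exact: measurable_rewardE. Qed.

(** [PrQ] imposes the action at time 0 only, while the iterated operator draws actions from time 1
    on, so the two descriptions agree. *)
Lemma disc_sumE f x a : (forall z, 0 <= f z) -> measurable_fun setT f ->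
  dsum f (x, a) = \sum_(t <oo) (gamma ^+ t)%:E *
     \int[PrQ T tpi x a]_w f (sa (0 + t)%N w).
Proof.
move=> f0 mf; have rl := PrQP T tpi x a; have [_ _ af sf] := rl.
rewrite -(integral_disc_sum af sf (n := 0))//.
rewrite (integral_sa0_from rl)//; first exact: disc_sum_ge0.
exact: measurable_disc_sum.
Qed.

(* [Qval] is not assumed jointly measurable: this expression through iterates of
   the transition operator shows that it is. *)
Lemma Qval_disc_sum z : [/\ dsum rewardE^\+ z \is a fin_num,
  dsum rewardE^\- z \is a fin_num &
  QE z = dsum rewardE^\+ z - dsum rewardE^\- z].
Proof.
case: z => x a; have [] := Rintegral_disc_return (Q_tpi x a).
by rewrite /ret_pos /ret_neg -!disc_sumE.
Qed.

Lemma measurable_QE : measurable_fun setT QE.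
Proof.
rewrite (_ : QE = fun z => dsum rewardE^\+ z - dsum rewardE^\- z); last first.
  by apply/funext => z; have [] := Qval_disc_sum z.
by apply: emeasurable_funB; exact: measurable_disc_sum.
Qed.

(** Used at time 0 under [Pr T tpi], to recover [J], and at time 1 under [PrQ], for the Bellman
    equation. *)
Lemma integral_QE P k n : actions_follow (st T) (act T) k tpi P ->
  states_follow M (st T) (act T) P -> (k <= n.+1)%N ->
  ret_pos P n \is a fin_num -> ret_neg P n \is a fin_num ->
  P.-integrable setT (QE \o sa n) /\
  \int[P]_w QE (sa n w) = ret_pos P n - ret_neg P n.
Proof.
move=> af sf kn pfin nfin.
have QEE : QE \o sa n =
    (fun w => dsum rewardE^\+ (sa n w) - dsum rewardE^\- (sa n w)).
  by apply/funext => w; have [] := Qval_disc_sum (sa n w).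
have ip : P.-integrable setT (fun w => dsum rewardE^\+ (sa n w)).
  apply/integrableP; split; first by apply: m_comp_sa; exact: measurable_disc_sum.
  under eq_integral do rewrite gee0_abs ?disc_sum_ge0//.
  by rewrite (integral_disc_sum af sf)// ltey_eq pfin.
have im : P.-integrable setT (fun w => dsum rewardE^\- (sa n w)).
  apply/integrableP; split; first by apply: m_comp_sa; exact: measurable_disc_sum.
  under eq_integral do rewrite gee0_abs ?disc_sum_ge0//.
  by rewrite (integral_disc_sum af sf)// ltey_eq nfin.
split; first by rewrite QEE; exact: integrableB.
rewrite -[LHS]/(\int[P]_w (QE \o sa n) w) QEE integralB//.
by rewrite !(integral_disc_sum af sf).
Qed.

Lemma disc_series_recl (a : nat -> \bar R) : (forall t, 0 <= a t) ->
  \sum_(t <oo) (gamma ^+ t)%:E * a t =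
  a 0%N + gamma%:E * \sum_(t <oo) (gamma ^+ t)%:E * a t.+1.
Proof.
move=> a0; rewrite nneseriesS; last by move=> t; rewrite mule_ge0 ?lee_fin.
rewrite expr0 mul1e; congr (_ + _).
rewrite -nneseriesZl; last by move=> t _; rewrite mule_ge0 ?lee_fin.
by apply: eq_eseriesr => t _; rewrite exprS EFinM muleA.
Qed.

Hypothesis V_tpi : forall x, (tpi x).-integrable setT (EFin \o Q x).
Hypothesis mV : measurable_fun setT (EFin \o V).

Lemma integral_act_Q x : \int[tpi x]_a QE (x, a) = (V x)%:E.
Proof. by rewrite /Vval /exp_act fineK// integrable_fin_num. Qed.

Lemma integral_QE_V P k n : actions_follow (st T) (act T) k tpi P -> (k <= n)%N ->
  P.-integrable setT (QE \o sa n) ->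
  P.-integrable setT (fun w => (V (st T n w))%:E) /\
  \int[P]_w QE (sa n w) = \int[P]_w (V (st T n w))%:E.
Proof.
move=> af kn iQ; have [iV VE] := integral_sa af kn measurable_QE iQ.
rewrite VE; split; last by apply: eq_integral => w _; rewrite integral_act_Q.
by apply: eq_integrable iV => // w _; rewrite integral_act_Q.
Qed.

Lemma J_initial_value : return_integrable (Pr T tpi) ->
  (J T tpi)%:E = \int[Pr T tpi]_w (V (st T 0%N w))%:E.
Proof.
move=> iJ; have [_ af sf] := PrP T tpi.
have [pfin nfin JE] := Rintegral_disc_return iJ.
have [iQ QJ] := integral_QE af sf (leq0n 1) pfin nfin.
have [_ <-] := integral_QE_V af (leq0n 0) iQ.
by rewrite QJ -JE.
Qed.

(* When [gamma = 0], the value function need not be integrable with respect to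
   the transition kernel. *)
Lemma bellman_integrable x a : gamma != 0%R ->
  (trans M (x, a)).-integrable setT (EFin \o V) /\
  QE (x, a) = rewardE (x, a) + gamma%:E * \int[trans M (x, a)]_s (V s)%:E.
Proof.
move=> g0; have rl := PrQP T tpi x a; have [_ _ af sf] := rl.
set P := PrQ T tpi x a in rl af sf *.
have [pfin nfin QJ] := Rintegral_disc_return (Q_tpi x a).
have posE : ret_pos P 0 = rewardE^\+ (x, a) + gamma%:E * ret_pos P 1.
  rewrite [LHS]disc_series_recl; last by move=> t; exact: integral_ge0.
  by rewrite (integral_sa0_from rl).
have negE : ret_neg P 0 = rewardE^\- (x, a) + gamma%:E * ret_neg P 1.
  rewrite [LHS]disc_series_recl; last by move=> t; exact: integral_ge0.
  by rewrite (integral_sa0_from rl).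
have gt0 : (0 < gamma)%R by rewrite lt_neqAle eq_sym g0 disc_ge0.
have pos1_ge0 : 0 <= ret_pos P 1.
  by apply: nneseries_ge0 => t _ _; rewrite mule_ge0 ?lee_fin ?integral_ge0.
have neg1_ge0 : 0 <= ret_neg P 1.
  by apply: nneseries_ge0 => t _ _; rewrite mule_ge0 ?lee_fin ?integral_ge0.
(* Finiteness passes from the discounted tail to the tail itself because [gamma > 0]. *)
have fin_tail (b c : \bar R) : 0 <= c -> b + gamma%:E * c \is a fin_num ->
    c \is a fin_num.
  move=> c0; rewrite fin_numD => /andP[_].
  by case: c c0 => // _; rewrite gt0_muley ?lte_fin.
have pfin1 : ret_pos P 1 \is a fin_num.
  by apply: (@fin_tail (rewardE^\+ (x, a)) _ pos1_ge0); rewrite -posE.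
have nfin1 : ret_neg P 1 \is a fin_num.
  by apply: (@fin_tail (rewardE^\- (x, a)) _ neg1_ge0); rewrite -negE.
have [iQ QE1] := integral_QE af sf (leqnn 2) pfin1 nfin1.
have [iV VE1] := integral_QE_V af (leqnn 1) iQ.
(* Under [P] the state at time 1 has law [trans M (x, a)]; this moves integrability from
   trajectories to the kernel. *)
have transE (h : S -> \bar R) : measurable_fun setT h -> (forall s, 0 <= h s) ->
    \int[P]_w h (st T 1 w) = \int[trans M (x, a)]_s h s.
  move=> mh h0; rewrite (ge0_integral_st sf)//.
  rewrite (integral_sa0_from rl (f := fun z => \int[trans M z]_s h s))//.
    by move=> z; exact: integral_ge0.
  by apply: measurable_fun_integral_kernel => // U mU; exact: measurable_kernel.
have iV' : (trans M (x, a)).-integrable setT (EFin \o V).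
  apply/integrableP; split => //.
  have mabsV : measurable_fun setT (abse \o (EFin \o V)).
    exact: measurableT_comp.
  rewrite -(transE _ mabsV) => [|s]; last exact: abse_ge0.
  by have /integrableP[] := iV.
split => //.
have <- : \int[P]_w QE (sa 1 w) = \int[trans M (x, a)]_s (V s)%:E.
  rewrite VE1 [RHS]integralE -!transE//; last 2 first.
  - exact: measurable_funeneg.
  - exact: measurable_funepos.
  rewrite [LHS]integralE; congr (_ - _); apply: eq_integral => w _.
    by rewrite !funeposE.
  by rewrite !funenegE.
rewrite QE1 -[LHS]/((Q x a)%:E) QJ posE negE.
have -> : rewardE (x, a) = rewardE^\+ (x, a) - rewardE^\- (x, a).
  by rewrite [in LHS](funeposneg rewardE).
have -> : rewardE^\+ (x, a) = (Num.max (reward M x a) 0)%:E.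
  by rewrite funeposE /rewardE EFin_max.
have -> : rewardE^\- (x, a) = (Num.max (- reward M x a) 0)%:E.
  by rewrite funenegE /rewardE EFin_max.
rewrite -(fineK pfin1) -(fineK nfin1) -!(EFinM, EFinB, EFinD).
by congr EFin; ring.
Qed.

End critic.
End performance_difference.

(** * The performance difference lemma *)

Section visitation.
Context (R : realType) (dS dA : measure_display)
  (S : measurableType dS) (A : measurableType dA) (M : mdp R S A).
Variables (T : rollout_space M) (mu : R.-pker S ~> A).
Local Open Scope ereal_scope.

Local Notation gamma := (disc M).

Lemma ge0_integral_rho f : measurable_fun setT f -> (forall s, 0 <= f s) ->
  \int[rho T mu]_s f s =
  \sum_(t <oo) (gamma ^+ t)%:E * \int[Pr T mu]_w f (st T t w).
Proof.
move=> mf f0; rewrite ge0_integral_measure_series//.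
apply: eq_eseriesr => t _; rewrite ge0_integral_mscale//=.
by rewrite ge0_integral_distribution.
Qed.

Variable f : S -> R.
Hypothesis fi : (rho T mu).-integrable setT (EFin \o f).

Let mf : measurable_fun setT (EFin \o f). Proof. exact: measurable_int fi. Qed.

Let Y t (w : rs_space T) : R := (gamma ^+ t * f (st T t w))%R.

Let mfst t : measurable_fun setT (fun w => (f (st T t w))%:E).
Proof. exact: measurableT_comp mf _. Qed.

Let mY t : measurable_fun setT (Y t).
Proof.
by apply/measurable_funM => //; apply/measurable_EFinP; exact: mfst.
Qed.

Let gX_ge0 t : (0 <= gamma ^+ t)%R.
Proof. by rewrite exprn_ge0 ?disc_ge0. Qed.

Let iY : \int[Pr T mu]_w \sum_(t <oo) `|Y t w|%:E < +oo.
Proof.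
have /integrableP[_] := fi; rewrite ge0_integral_rho//; last first.
  exact: measurableT_comp.
rewrite integral_nneseries//; last first.
  by move=> t; apply/measurable_EFinP; exact: measurableT_comp.
congr (_ < _); apply: eq_eseriesr => t _.
rewrite -ge0_integralZl ?lee_fin//; last first.
  by apply: measurableT_comp => //; exact: mfst.
by apply: eq_integral => w _; rewrite /Y /= normrM ger0_norm.
Qed.

Lemma integrable_rho_term t :
  (Pr T mu).-integrable setT (fun w => (gamma ^+ t * f (st T t w))%:E).
Proof. exact: integrable_term mY iY t. Qed.

(** Replaces the integral against a series of measures by a limit of sums over time, in which
    telescoping and termwise estimates are possible. *)
Lemma cvg_exp_rho :
  (series (fun t => \int[Pr T mu]_w (gamma ^+ t * f (st T t w))) @ \oo -->
   exp_rho T mu f)%R.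
Proof.
have [_ +] := cvg_Rintegral_series mY iY; rewrite /Y; congr (_ --> _).
have [_ _ YE] := Rintegral_limn_series mY iY.
rewrite /exp_rho [in RHS]/Rintegral [in RHS]integralE.
rewrite !ge0_integral_rho//; last 2 first.
- exact: measurable_funeneg.
- exact: measurable_funepos.
apply: EFin_inj; rewrite YE.
have posE : \sum_(t <oo) \int[Pr T mu]_w (EFin \o Y t)^\+ w =
    \sum_(t <oo) (gamma ^+ t)%:E * \int[Pr T mu]_w (EFin \o f)^\+ (st T t w).
  apply: eq_eseriesr => t _; rewrite -ge0_integralZl ?lee_fin//; last first.
    by apply: measurableT_comp => //; exact: measurable_funepos.
  apply: eq_integral => w _.
  rewrite !funeposE -[(EFin \o Y t) w]/((gamma ^+ t)%:E * (f (st T t w))%:E).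
  by rewrite maxe_pMr ?lee_fin// mule0.
have negE : \sum_(t <oo) \int[Pr T mu]_w (EFin \o Y t)^\- w =
    \sum_(t <oo) (gamma ^+ t)%:E * \int[Pr T mu]_w (EFin \o f)^\- (st T t w).
  apply: eq_eseriesr => t _; rewrite -ge0_integralZl ?lee_fin//; last first.
    by apply: measurableT_comp => //; exact: measurable_funeneg.
  apply: eq_integral => w _.
  rewrite !funenegE -[(EFin \o Y t) w]/((gamma ^+ t)%:E * (f (st T t w))%:E).
  by rewrite -muleN maxe_pMr ?lee_fin// mule0.
by rewrite posE negE fineK// -posE -negE -YE.
Qed.

End visitation.

Section performance_difference.
Context (R : realType) (dS dA : measure_display)
  (S : measurableType dS) (A : measurableType dA) (M : mdp R S A).
Variables (T : rollout_space M) (pi tpi : R.-pker S ~> A).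
Local Notation gamma := (disc M).
Local Notation sa := (sa_pair (st T) (act T)).
Local Notation Q := (Qval T tpi).
Local Notation V := (Vval T tpi).
Hypothesis J_pi : return_integrable (Pr T pi).
Hypothesis J_tpi : return_integrable (Pr T tpi).
Hypothesis Q_tpi : forall x a, return_integrable (PrQ T tpi x a).
Hypothesis V_tpi : forall x, (tpi x).-integrable setT (EFin \o Q x).
Hypothesis A_pi : forall x, (pi x).-integrable setT (EFin \o Aval T tpi x).
Hypothesis rho_pi_V : (rho T pi).-integrable setT (EFin \o V).

Let mV : measurable_fun setT (EFin \o V).
Proof. exact: measurable_int rho_pi_V. Qed.

Local Notation h := (exp_next M V).

Lemma bellman x a : Q x a = reward M x a + gamma * h (x, a).
Proof.
(* For [gamma = 0] the integral [h] may be a default value, but its coefficient vanishes and the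
   return is the first reward. *)
have [g0|g0] := eqVneq gamma 0.
  rewrite g0 mul0r addr0; have rl := PrQP T tpi x a.
  have [_ _ QJ] := Rintegral_disc_return (Q_tpi x a).
  have mr := measurable_rewardE M.
  have posE : ret_pos (PrQ T tpi x a) 0 = (rewardE M)^\+%E (x, a).
    rewrite [LHS]disc_series_recl; last by move=> t; exact: integral_ge0.
    rewrite g0 mul0e adde0 (integral_sa0_from rl)//.
    exact: measurable_funepos.
  have negE : ret_neg (PrQ T tpi x a) 0 = (rewardE M)^\-%E (x, a).
    rewrite [LHS]disc_series_recl; last by move=> t; exact: integral_ge0.
    rewrite g0 mul0e adde0 (integral_sa0_from rl)//.
    exact: measurable_funeneg.
  apply: EFin_inj; rewrite [LHS]QJ posE negE.
  by rewrite -[RHS]/(rewardE M (x, a)) [in RHS](funeposneg (rewardE M)).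
have [iV QV] := bellman_integrable Q_tpi V_tpi mV x a g0.
have hE : ((h (x, a))%:E = \int[trans M (x, a)]_s (V s)%:E)%E.
  by rewrite fineK//; exact: integrable_fin_num iV.
by apply: EFin_inj; rewrite EFinD EFinM hE; exact: QV.
Qed.

Local Notation P := (Pr T pi).

Let iVt t : P.-integrable setT (fun w => (gamma ^+ t * V (st T t w))%:E).
Proof. exact: integrable_rho_term. Qed.

(** [h] is the conditional expectation of the next value. Keeping the weight [gamma ^+ t.+1] inside
    makes both sides vanish when [gamma = 0]. *)
Lemma trans_value_term t :
  P.-integrable setT (fun w => (gamma ^+ t.+1 * h (sa t w))%:E) /\
  \int[P]_w (gamma ^+ t.+1 * V (st T t.+1 w)) =
  \int[P]_w (gamma ^+ t.+1 * h (sa t w)).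
Proof.
have [g0|g0] := eqVneq gamma 0.
  rewrite g0 expr0n /=; split; last by apply: eq_Rintegral => w _; rewrite !mul0r.
  under eq_fun do rewrite mul0r.
  exact: integrable0.
have [_ _ sf] := PrP T pi.
pose g s := (gamma ^+ t.+1 * V s)%:E.
have mg : measurable_fun setT g.
  rewrite (_ : g = fun s => (gamma ^+ t.+1)%:E * (V s)%:E)%E//.
  exact: emeasurable_funM.
have [ig gE] := integral_st sf mg (iVt t.+1).
have hE z : (\int[trans M z]_s g s = (gamma ^+ t.+1 * h z)%:E)%E.
  case: z => x a.
  have [iV _] := bellman_integrable Q_tpi V_tpi mV x a g0.
  rewrite /g; under eq_integral do rewrite EFinM.
  by rewrite integralZl// EFinM /exp_next fineK// integrable_fin_num.
split.
  by apply: eq_integrable ig => // w _; rewrite hE.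
rewrite /Rintegral -/(g _) gE; congr fine.
by apply: eq_integral => w _; rewrite hE.
Qed.

(** By [bellman] the advantage at time [t] is reward plus [gamma * h] minus [V]. Averaging over the
    action gives [barA], and conditioning replaces [h] by the next value, leaving a telescoping
    difference. *)
Lemma advantage_step t :
  \int[P]_w (gamma ^+ t * barA T pi tpi (st T t w)) =
  \int[P]_w (gamma ^+ t * reward M (st T t w) (act T t w)) +
  (\int[P]_w (gamma ^+ t.+1 * V (st T t.+1 w)) -
   \int[P]_w (gamma ^+ t * V (st T t w))).
Proof.
have [_ af _] := PrP T pi.
have [ih hE] := trans_value_term t.
have ir : P.-integrable setT
    (fun w => (gamma ^+ t * reward M (st T t w) (act T t w))%:E).
  exact: integrable_reward_term.
rewrite hE -(RintegralB measurableT ih (iVt t)).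
have iB : P.-integrable setT
  (fun w => (gamma ^+ t.+1 * h (sa t w) - gamma ^+ t * V (st T t w))%:E).
  exact: (integrableB measurableT ih (iVt t)).
rewrite -(RintegralD measurableT ir iB).
pose f z := (gamma ^+ t * Aval T tpi z.1 z.2)%:E.
have mA : measurable_fun setT (fun z : S * A => (Aval T tpi z.1 z.2)%:E).
  apply/measurable_EFinP; apply: measurable_funB.
    by apply/measurable_EFinP; exact: measurable_QE.
  by apply: measurableT_comp (measurable_fst); exact/measurable_EFinP.
have mf : measurable_fun setT f.
  rewrite (_ : f = fun z => (gamma ^+ t)%:E * (Aval T tpi z.1 z.2)%:E)%E//.
  exact: emeasurable_funM.
have fE w : (f (sa t w) = (gamma ^+ t * reward M (st T t w) (act T t w) +
   (gamma ^+ t.+1 * h (sa t w) - gamma ^+ t * V (st T t w)))%:E)%E.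
  by rewrite /f /Aval /= bellman exprSr; congr EFin; ring.
have fi : P.-integrable setT (f \o sa t).
  apply: eq_integrable (integrableD measurableT ir iB) => // w _.
  exact: esym (fE w).
have [_ IE] := integral_sa af (leq0n t) mf fi.
rewrite /Rintegral; under [in RHS]eq_integral do rewrite -fE.
rewrite IE; congr fine; apply: eq_integral => w _.
rewrite /f /=; under [RHS]eq_integral do rewrite EFinM.
by rewrite integralZl// EFinM /barA /exp_act fineK// integrable_fin_num.
Qed.

Hypothesis rho_pi_A : (rho T pi).-integrable setT (EFin \o barA T pi tpi).

Lemma performance_difference :
  J T pi - J T tpi = exp_rho T pi (barA T pi tpi).
Proof.
(* The values are those of [tpi] but the trajectory follows [pi]: both policies start from
   [init M]. *)
have V0 : \int[P]_w V (st T 0%N w) = J T tpi.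
  have initE mu (g : S -> \bar R) : measurable_fun setT g ->
      (forall s, 0 <= g s)%E ->
      (\int[Pr T mu]_w g (st T 0%N w) = \int[init M]_s g s)%E.
    move=> mg g0.
    transitivity (\int[distribution (Pr T mu) (st T 0%N)]_s g s)%E.
      by rewrite ge0_integral_distribution.
    apply: eq_measure_integral => B mB _.
    by have [Pinit _ _] := PrP T mu; exact: Pinit.
  have initV mu : (\int[Pr T mu]_w (V (st T 0%N w))%:E =
      \int[init M]_s (V s)%:E)%E.
    rewrite [RHS]integralE -!(initE mu)//; last 2 first.
    - exact: measurable_funeneg.
    - exact: measurable_funepos.
    rewrite [LHS]integralE; congr (_ - _)%E; apply: eq_integral => w _.
      by rewrite !funeposE.
    by rewrite !funenegE.
  apply: EFin_inj.
  rewrite (J_initial_value Q_tpi V_tpi J_tpi) initV -(initV pi) /Rintegral.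
  rewrite fineK//; apply: integrable_fin_num => //.
  apply: eq_integrable (iVt 0%N) => // w _.
  by rewrite expr0 mul1r.
pose u n := \int[P]_w (gamma ^+ n * V (st T n w)).
(* The boundary term of the telescoping sum vanishes as the general term of the convergent series
   for the integral of [V] against [rho T pi]. *)
have cu : u @ \oo --> 0 by exact: cvg_series_cvg_0 (cvgP _ (cvg_exp_rho rho_pi_V)).
have := cvg_exp_rho rho_pi_A => cA.
have serE : series (fun t => \int[P]_w (gamma ^+ t * barA T pi tpi (st T t w))) =
  (fun n => series (fun t => \int[P]_w (gamma ^+ t * reward M (st T t w) (act T t w))) n
    + (u n - u 0%N)).
  have tele (a b c d e : R) : a + (b - c) + (d + (e - b)) = a + d + (e - c).
    by ring.
  apply/funext => n; rewrite /series/=; elim: n => [|n ih].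
    by rewrite !big_geq// subrr addr0.
  by rewrite !(big_nat_recr n)//= ih advantage_step; exact: tele.
have cB : series (fun t => \int[P]_w (gamma ^+ t * barA T pi tpi (st T t w))) @ \oo -->
    J T pi + (0 - u 0%N).
  rewrite serE; apply: cvgD; first exact: cvg_disc_return.
  by apply: cvgB => //; exact: cvg_cst.
have -> : exp_rho T pi (barA T pi tpi) = J T pi + (0 - u 0%N).
  exact: cvg_unique cA cB.
rewrite sub0r -V0; congr (_ - _).
by rewrite /u; apply: eq_Rintegral => w _; rewrite expr0 mul1r.
Qed.

End performance_difference.

(** * Perturbation of the visitation measure *)

Lemma measurable_Rintegral_kernel d d' (X : measurableType d)
    (Y : measurableType d') (R : realType) (k : R.-pker X ~> Y)
    (f : X * Y -> R) : measurable_fun setT f ->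
  measurable_fun setT (fun x => \int[k x]_y f (x, y)).
Proof.
move=> mf; have mfE : measurable_fun setT (EFin \o f) by exact/measurable_EFinP.
rewrite /Rintegral; apply: measurableT_comp; first exact: fine_measurable.
rewrite (_ : (fun x => _) = fun x =>
  (\int[k x]_y (EFin \o f)^\+%E (x, y) - \int[k x]_y (EFin \o f)^\-%E (x, y))%E).
  apply: emeasurable_funB; apply: measurable_fun_integral_finite_kernel => //.
    exact: measurable_funepos.
  exact: measurable_funeneg.
apply/funext => x; rewrite integralE; congr (_ - _)%E; apply: eq_integral => y _.
  by rewrite !funeposE.
by rewrite !funenegE.
Qed.

Lemma cvg_norm_le (R : realType) (u : R^nat) (l C : R) :
  u @ \oo --> l -> (forall n, `|u n| <= C) -> `|l| <= C.
Proof.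
move=> ul uC; have ul' : (fun n => `|u n|) @ \oo --> `|l| by exact: cvg_norm.
rewrite -(cvg_lim _ ul')//; apply: limr_le; first exact: cvgP ul'.
exact: nearW.
Qed.

Lemma sum_geometric_le (R : realType) (g : R) n : 0 <= g -> g < 1 ->
  \sum_(0 <= t < n) g ^+ t <= (1 - g)^-1.
Proof.
move=> g0 g1; have g1' : 0 < 1 - g by rewrite subr_gt0.
rewrite -[leRHS]mul1r ler_pdivlMr// big_mkord.
have -> : (\sum_(i < n) g ^+ i) * (1 - g) = 1 - g ^+ n.
  by rewrite mulrC -opprB mulNr -subrX1 opprB.
by rewrite lerBlDr lerDl exprn_ge0.
Qed.

Lemma sum_arith_geometric_le (R : realType) (g : R) n : 0 <= g -> g < 1 ->
  \sum_(0 <= t < n) g ^+ t * t%:R <= g / (1 - g) ^+ 2.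
Proof.
move=> g0 g1; have g1' : 0 < 1 - g by rewrite subr_gt0.
rewrite ler_pdivlMr ?exprn_gt0//.
(* Exact value of the partial sum; the subtracted remainder is nonnegative. *)
have -> : (\sum_(0 <= t < n) g ^+ t * t%:R) * (1 - g) ^+ 2 =
    g - g ^+ n * (n%:R * (1 - g) + g).
  elim: n => [|n ih]; first by rewrite big_geq//; ring.
  by rewrite big_nat_recr//= mulrDl ih [g ^+ n.+1]exprS -natr1; ring.
rewrite lerBlDr lerDl mulr_ge0 ?exprn_ge0// addr_ge0// mulr_ge0//; exact: ltW.
Qed.

Section visitation_gap.
Context (R : realType) (dS dA : measure_display)
  (S : measurableType dS) (A : measurableType dA) (M : mdp R S A).
Variable T : rollout_space M.
Local Notation gamma := (disc M).
Local Notation sa := (sa_pair (st T) (act T)).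

Let gX_ge0 t : 0 <= gamma ^+ t.
Proof. by rewrite exprn_ge0 ?disc_ge0. Qed.

Definition exp_state mu t (f : S -> R) : R := \int[Pr T mu]_w f (st T t w).

Let m_st t (f : S -> R) : measurable_fun setT f ->
  measurable_fun setT (fun w => f (st T t w)).
Proof. by move=> mf; exact: measurableT_comp mf _. Qed.

Lemma norm_exp_state_le mu t (f : S -> R) B : measurable_fun setT f ->
  (forall s, `|f s| <= B) -> `|exp_state mu t f| <= B.
Proof. by move=> mf fB; apply: norm_Rintegral_le => //; exact: m_st. Qed.

Let measurable_exp_next (f : S -> R) : measurable_fun setT f -> measurable_fun setT (exp_next M f).
Proof.
move=> mf.
apply: (measurable_Rintegral_kernel (trans M) (f := fun zs => f zs.2)).
exact: measurableT_comp.
Qed.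

Let norm_exp_next_le (f : S -> R) B : measurable_fun setT f -> (forall s, `|f s| <= B) ->
  forall z, `|exp_next M f z| <= B.
Proof.
by move=> mf fB z; exact: (norm_Rintegral_le (ker_at (trans M) z) mf fB).
Qed.

Let measurable_act mu (h : S * A -> R) : measurable_fun setT h ->
  measurable_fun setT (exp_act mu (fun s a => h (s, a))).
Proof. exact: measurable_Rintegral_kernel. Qed.

Let norm_act_le mu (h : S * A -> R) B : measurable_fun setT h ->
  (forall z, `|h z| <= B) -> forall s, `|exp_act mu (fun s a => h (s, a)) s| <= B.
Proof.
move=> mh hB s; apply: (norm_Rintegral_le (ker_at mu s)) => //.
exact: measurableT_comp.
Qed.

(** Conditioning on the state at time [t] isolates the policy in a single average over actions. *)
Lemma exp_stateS mu t (f : S -> R) B : measurable_fun setT f ->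
  (forall s, `|f s| <= B) ->
  exp_state mu t.+1 f = exp_state mu t (exp_act mu (fun s a => exp_next M f (s, a))).
Proof.
move=> mf fB; have [_ af sf] := PrP T mu.
have mfE : measurable_fun setT (EFin \o f) by exact/measurable_EFinP.
have fi z : (trans M z).-integrable setT (EFin \o f).
  exact: (bounded_integrable (ker_at (trans M) z) mf fB).
have fi1 : (Pr T mu).-integrable setT ((EFin \o f) \o st T t.+1).
  by apply: (bounded_integrable _ (B := B)) => //; exact: m_st.
have pE z : (\int[trans M z]_s (EFin \o f) s = (exp_next M f z)%:E)%E.
  by rewrite /exp_next fineK//; exact: integrable_fin_num (fi z).
have mp := measurable_exp_next mf; have pB := norm_exp_next_le mf fB.
have mpE : measurable_fun setT (EFin \o exp_next M f) by exact/measurable_EFinP.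
have [_ E1] := integral_st sf mfE fi1.
have pi1 : (Pr T mu).-integrable setT ((EFin \o exp_next M f) \o sa t).
  apply: (bounded_integrable _ (B := B)) => //.
  by apply: measurableT_comp mp _; exact: measurable_sa.
have [_ E2] := integral_sa af (leq0n t) mpE pi1.
rewrite /exp_state /Rintegral E1; congr fine.
transitivity (\int[Pr T mu]_w (EFin \o exp_next M f) (sa t w))%E.
  by apply: eq_integral => w _; exact: pE.
rewrite E2; apply: eq_integral => w _.
rewrite /exp_act /Rintegral fineK//; apply: integrable_fin_num => //.
apply: (bounded_integrable (ker_at mu (st T t w)) (B := B)) => //.
exact: measurableT_comp.
Qed.

Variables (pi1 pi2 : R.-pker S ~> A) (D : R).
Hypothesis D_ge0 : 0 <= D.
(** An L1 distance bound in dual form. [D] is abstract because it will be [2 * sqrt k] for a finite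
    divergence bound and the trivial [2] otherwise. *)
Hypothesis policy_gap : forall s (h : A -> R) B, measurable_fun setT h ->
  (forall a, `|h a| <= B) -> `|\int[pi1 s]_a h a - \int[pi2 s]_a h a| <= B * D.

Lemma state_gap t (f : S -> R) B : measurable_fun setT f ->
  (forall s, `|f s| <= B) -> `|exp_state pi1 t f - exp_state pi2 t f| <= t%:R * (B * D).
Proof.
elim: t f => [|t ih] f mf fB.
  have mfE : measurable_fun setT (EFin \o f) by exact/measurable_EFinP.
  (* The initial law is common to all policies, so the gap starts at zero; hence the factor [t]
     rather than [t.+1]. *)
  have initE mu : exp_state mu 0%N f = \int[init M]_s f s.
    have fi : (Pr T mu).-integrable setT ((EFin \o f) \o st T 0%N).
      by apply: (bounded_integrable _ (B := B)) => //; exact: m_st.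
    rewrite /exp_state /Rintegral; congr fine.
    transitivity (\int[distribution (Pr T mu) (st T 0%N)]_s (f s)%:E)%E.
      by rewrite (integral_distribution mfE fi).
    apply: eq_measure_integral => C mC _.
    by have [Pinit _ _] := PrP T mu; exact: Pinit.
  by rewrite !initE subrr normr0 mul0r.
rewrite !(exp_stateS _ _ mf fB).
have mp := measurable_exp_next mf; have pB := norm_exp_next_le mf fB.
set g1 := exp_act pi1 _; set g2 := exp_act pi2 _.
have mg1 : measurable_fun setT g1 by exact: measurable_act.
have mg2 : measurable_fun setT g2 by exact: measurable_act.
have g1B s : `|g1 s| <= B by exact: norm_act_le.
have g2B s : `|g2 s| <= B by exact: norm_act_le.
have gi (g : S -> R) : measurable_fun setT g -> (forall s, `|g s| <= B) ->
    (Pr T pi2).-integrable setT (fun w => (g (st T t w))%:E).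
  by move=> mg gB; apply: (bounded_integrable _ (B := B)) => //; exact: m_st.
(* Hybrid argument: the first difference has one test function and two state laws, for the induction
   hypothesis; the second changes only the last action. *)
have -> : exp_state pi1 t g1 - exp_state pi2 t g2 =
    (exp_state pi1 t g1 - exp_state pi2 t g1) + exp_state pi2 t (fun s => g1 s - g2 s).
  by rewrite /exp_state RintegralB//; [ring|exact: gi|exact: gi].
rewrite -natr1 mulrDl mul1r; apply: (le_trans (ler_normD _ _)).
apply: lerD; first exact: ih.
apply: norm_exp_state_le; first exact: measurable_funB.
move=> s; apply: policy_gap => //.
exact: measurableT_comp.
Qed.

Variables (f : S -> R) (B : R).
Hypothesis mf : measurable_fun setT f.
Hypothesis fB : forall s, `|f s| <= B.

Lemma bounded_rho_integrable mu : (rho T mu).-integrable setT (EFin \o f).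
Proof.
apply/integrableP; split; first exact/measurable_EFinP.
rewrite ge0_integral_rho//; last first.
  by apply: measurableT_comp => //; exact/measurable_EFinP.
have [s0] := probability_inhabited (init M).
have B0 : 0 <= B by exact: le_trans (fB s0).
have gs0 : 0 <= (1 - gamma)^-1 by rewrite invr_ge0 subr_ge0 ltW ?disc_lt1.
apply: (@le_lt_trans _ _ (B * (1 - gamma)^-1)%:E); last exact: ltry.
have term t : ((gamma ^+ t)%:E * \int[Pr T mu]_w `|(EFin \o f) (st T t w)| <=
    (gamma ^+ t * B)%:E)%E.
  have mfE : measurable_fun setT (EFin \o f) by exact/measurable_EFinP.
  have mfst : measurable_fun setT (fun w => (EFin \o f) (st T t w)).
    exact: measurableT_comp mfE _.
  rewrite EFinM lee_wpmul2l ?lee_fin//.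
  have := @ge0_le_integral _ _ _ (Pr T mu) setT measurableT
    (fun w => `|(EFin \o f) (st T t w)|)%E (cst B%:E).
  rewrite integral_cst// [X in (_ * X)%E](probability_setT (Pr T mu)) mule1.
  apply=> //; first exact: measurableT_comp.
  by move=> w _; rewrite /= lee_fin.
apply: lime_le.
  apply: is_cvg_nneseries => t _ _; rewrite mule_ge0 ?lee_fin//.
  exact: integral_ge0.
apply: nearW => n; apply: le_trans (lee_sum _ (fun t _ => term t)) _.
rewrite sumEFin lee_fin -mulr_suml mulrC ler_wpM2l//.
by apply: sum_geometric_le; [exact: disc_ge0|exact: disc_lt1].
Qed.

Let seriesE mu n :
  series (fun t => \int[Pr T mu]_w (gamma ^+ t * f (st T t w))) n =
  \sum_(0 <= t < n) gamma ^+ t * exp_state mu t f.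
Proof.
apply: eq_bigr => t _; rewrite /exp_state (RintegralZl _ measurableT)//.
by apply: (bounded_integrable _ (B := B)) => //; exact: m_st.
Qed.

Lemma norm_exp_rho_le mu : `|exp_rho T mu f| <= B / (1 - gamma).
Proof.
have [s0] := probability_inhabited (init M).
have B0 : 0 <= B by exact: le_trans (fB s0).
apply: cvg_norm_le (cvg_exp_rho (bounded_rho_integrable mu)) _ => n.
rewrite seriesE; apply: (le_trans (ler_norm_sum _ _ _)).
apply: (@le_trans _ _ (\sum_(0 <= t < n) gamma ^+ t * B)).
  apply: ler_sum => t _; rewrite normrM ger0_norm// ler_wpM2l//.
  exact: norm_exp_state_le.
rewrite -mulr_suml mulrC ler_wpM2l//.
by apply: sum_geometric_le; [exact: disc_ge0|exact: disc_lt1].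
Qed.

Lemma norm_exp_rho_gap_le :
  `|exp_rho T pi1 f - exp_rho T pi2 f| <= gamma / (1 - gamma) ^+ 2 * (B * D).
Proof.
have [s0] := probability_inhabited (init M).
have B0 : 0 <= B by exact: le_trans (fB s0).
have c1 := cvg_exp_rho (bounded_rho_integrable pi1).
have c2 := cvg_exp_rho (bounded_rho_integrable pi2).
apply: cvg_norm_le (cvgB c1 c2) _ => n.
rewrite -[X in `|X|]/(series _ n - series _ n) !seriesE -sumrB.
apply: (le_trans (ler_norm_sum _ _ _)).
apply: (@le_trans _ _ (\sum_(0 <= t < n) gamma ^+ t * t%:R * (B * D))).
  apply: ler_sum => t _; rewrite -mulrBr normrM ger0_norm// -mulrA ler_wpM2l//.
  exact: state_gap.
rewrite -mulr_suml ler_wpM2r ?mulr_ge0//.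
by apply: sum_arith_geometric_le; [exact: disc_ge0|exact: disc_lt1].
Qed.

End visitation_gap.

(** * The error bounds *)

(** The combination takes place in [\bar R] since divergences may be infinite; distributivity holds
    because both terms are nonnegative. The weight [n] will be [nu] for the first objective and [1]
    for the second. *)
Lemma combine_error_bounds (R : realType) (c n e z a g1 g2 r : R)
    (k1 k2 : \bar R) : 0 <= c -> 0 <= n -> 0 <= e -> 0 <= z ->
  `|a| <= r ->
  (`|g1|%:E <= c%:E * (z%:E * sqrte k1))%E ->
  (`|g2|%:E <= c%:E * (e%:E * sqrte k2))%E ->
  (`|a + (n * g2 + g1)|%:E <=
   r%:E + c%:E * ((n * e)%:E * sqrte k2 + z%:E * sqrte k1))%E.
Proof.
move=> c0 n0 e0 z0 ar g1P g2P.
apply: (@le_trans _ _ (`|a| + (n * `|g2| + `|g1|))%:E).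
  rewrite lee_fin; apply: (le_trans (ler_normD _ _)); rewrite lerD2l.
  by apply: (le_trans (ler_normD _ _)); rewrite normrM ger0_norm.
have k10 := sqrte_ge0 k1; have k20 := sqrte_ge0 k2.
rewrite ge0_muleDr; last 2 first.
- by rewrite mule_ge0// lee_fin mulr_ge0.
- by rewrite mule_ge0// lee_fin.
rewrite EFinD leeD ?lee_fin// EFinD leeD//.
have -> : (c%:E * ((n * e)%:E * sqrte k2) =
    n%:E * (c%:E * (e%:E * sqrte k2)))%E.
  by rewrite EFinM -[X in (_ * X)%E = _]muleA [LHS]muleCA.
by rewrite EFinM lee_wpmul2l ?lee_fin.
Qed.

Section visitation_gap_kl.
Context (R : realType) (dS dA : measure_display)
  (S : measurableType dS) (A : measurableType dA) (M : mdp R S A).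
Variables (T : rollout_space M) (pi1 pi2 : R.-pker S ~> A).
Variables (f : S -> R) (B : R).
Hypothesis mf : measurable_fun setT f.
Hypothesis fB : forall s, `|f s| <= B.
Local Notation gamma := (disc M).

Let gap_of_kl k : 0 <= k -> (kl_max pi1 pi2 <= k%:E)%E ->
  `|exp_rho T pi1 f - exp_rho T pi2 f| <=
  gamma / (1 - gamma) ^+ 2 * (B * (2 * Num.sqrt k)).
Proof.
move=> k0 klk; apply: norm_exp_rho_gap_le => //.
move=> s h C mh hC.
apply: (@Rintegral_gap_le_kl _ _ _ (ker_at pi1 s) (ker_at pi2 s)) => //.
by apply: le_trans klk; apply: ereal_sup_ubound; exists s.
Qed.

Let gap_trivial : `|exp_rho T pi1 f - exp_rho T pi2 f| <=
  gamma / (1 - gamma) ^+ 2 * (B * 2).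
Proof.
apply: norm_exp_rho_gap_le => // s h C mh hC.
apply: (le_trans (ler_normB _ _)); rewrite mulr_natr mulr2n.
by apply: lerD; [exact: (norm_Rintegral_le (ker_at pi1 s))|
                 exact: (norm_Rintegral_le (ker_at pi2 s))].
Qed.

Lemma exp_rho_gap_le_kl :
  (`|exp_rho T pi1 f - exp_rho T pi2 f|%:E <=
   (2 * gamma / (1 - gamma) ^+ 2)%:E * (B%:E * sqrte (kl_max pi1 pi2)))%E.
Proof.
have [s0] := probability_inhabited (init M).
have B0 : 0 <= B by exact: le_trans (fB s0).
have g1 : 0 < 1 - gamma by rewrite subr_gt0 disc_lt1.
have g0 : 0 <= gamma := disc_ge0 M.
have c0 : 0 <= 2 * gamma / (1 - gamma) ^+ 2.
  by rewrite !mulr_ge0// invr_ge0 exprn_ge0// ltW.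
have rhs_ge0 k : (0 <= (2 * gamma / (1 - gamma) ^+ 2)%:E * (B%:E * sqrte k))%E.
  by apply: mule_ge0; [rewrite lee_fin|apply: mule_ge0; [|exact: sqrte_ge0]].
case kE : (kl_max pi1 pi2) => [k| |].
- have [k0|k0] := leP 0 k.
    rewrite -!EFinM lee_fin; apply: (le_trans (gap_of_kl k0 _)); first by rewrite kE.
    by rewrite le_eqVlt; apply/predU1P; left; ring.
  (* A negative value is relaxed to [k = 0], for which the gap is zero. *)
  apply: (@le_trans _ _ 0%E); last exact: rhs_ge0.
  rewrite lee_fin; apply: (le_trans (gap_of_kl (lexx 0) _)).
    by rewrite kE lee_fin ltW.
  by rewrite sqrtr0 !mulr0.
(* With an infinite divergence and a zero coefficient the right-hand side is [0 * oo = 0];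
   [gap_trivial] shows that the gap is zero as well. *)
- have [c_eq0|c_neq0] := eqVneq (2 * gamma / (1 - gamma) ^+ 2 * B) 0.
    apply: (@le_trans _ _ 0%E); last exact: rhs_ge0.
    rewrite lee_fin; apply: (le_trans gap_trivial).
    by rewrite -c_eq0 le_eqVlt; apply/predU1P; left; ring.
  rewrite muleA -EFinM /= gt0_muley ?leey// lte_fin lt_neqAle eq_sym c_neq0.
  by rewrite mulr_ge0.
- apply: (@le_trans _ _ 0%E); last exact: rhs_ge0.
  rewrite lee_fin; apply: (le_trans (gap_of_kl (lexx 0) _)); first by rewrite kE leNye.
  by rewrite sqrtr0 !mulr0.
Qed.

End visitation_gap_kl.

Theorem theorem2 (R : realType) (dS dA : measure_display)
    (S : measurableType dS) (A : measurableType dA)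
    (M : mdp R S A) (T : rollout_space M)
    (pi tpi beta : R.-pker S ~> A) (Qw : S -> A -> R) (nu : R)
    (nu_ge0 : 0 <= nu) (nu_le1 : nu <= 1)
    (* standing assumption: the expectations and values are well defined *)
    (J_pi : return_integrable (Pr T pi))
    (J_tpi : return_integrable (Pr T tpi))
    (Q_tpi : forall x a, return_integrable (PrQ T tpi x a))
    (V_tpi : forall x, (tpi x).-integrable setT (EFin \o Qval T tpi x))
    (A_pi : forall x, (pi x).-integrable setT (EFin \o Aval T tpi x))
    (Qw_tpi : forall x, (tpi x).-integrable setT (EFin \o Qw x))
    (Aw_pi : forall x, (pi x).-integrable setT (EFin \o adv Qw tpi x))
    (rho_pi_V : (rho T pi).-integrable setT (EFin \o Vval T tpi))
    (rho_tpi_A : (rho T tpi).-integrable setT (EFin \o barA T pi tpi))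
    (rho_tpi_AAw : (rho T tpi).-integrable setT
       (EFin \o exp_act pi (fun x a => Aval T tpi x a - adv Qw tpi x a)))
    (rho_beta_Aw : (rho T beta).-integrable setT (EFin \o barAw Qw pi tpi))
    (* standing assumption: the maxima of real quantities are finite *)
    (delta_fin : has_ubound (critic_errors T Qw tpi))
    (eps_fin : has_ubound (range (fun x => `|barAw Qw pi tpi x|)))
    (zeta_fin : has_ubound (range (fun x => `|barA T pi tpi x|))) :
  let gamma := disc M in
  let delta := sup (critic_errors T Qw tpi) in
  let eps := sup (range (fun x => `|barAw Qw pi tpi x|)) in
  let zeta := sup (range (fun x => `|barA T pi tpi x|)) in
  (`|J T pi - Jtilde T Qw beta nu pi tpi|%:E <=
     (nu * delta / (1 - gamma))%:E +
     (2 * gamma / (1 - gamma) ^+ 2)%:E *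
       ((nu * eps)%:E * sqrte (kl_max tpi beta) +
        zeta%:E * sqrte (kl_max pi tpi)))%E /\
  (`|J T pi - JtildeCV T Qw beta nu pi tpi|%:E <=
     (nu * delta / (1 - gamma))%:E +
     (2 * gamma / (1 - gamma) ^+ 2)%:E *
       (eps%:E * sqrte (kl_max tpi beta) +
        zeta%:E * sqrte (kl_max pi tpi)))%E.

Proof.
move=> gamma delta eps zeta.
have g1 : 0 < 1 - gamma by rewrite subr_gt0 disc_lt1.
have c0 : 0 <= 2 * gamma / (1 - gamma) ^+ 2.
  by rewrite !mulr_ge0 ?disc_ge0// invr_ge0 exprn_ge0// ltW.
have [s0] := probability_inhabited (init M).
have epsP x : `|barAw Qw pi tpi x| <= eps.
  by apply: (ub_le_sup eps_fin); exists x.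
have zetaP x : `|barA T pi tpi x| <= zeta.
  by apply: (ub_le_sup zeta_fin); exists x.
have eps0 : 0 <= eps by exact: le_trans (epsP s0).
have zeta0 : 0 <= zeta by exact: le_trans (zetaP s0).
have mA : measurable_fun setT (barA T pi tpi).
  by apply/measurable_EFinP; exact: measurable_int rho_tpi_A.
have mAw : measurable_fun setT (barAw Qw pi tpi).
  by apply/measurable_EFinP; exact: measurable_int rho_beta_Aw.
(* By linearity this is the average over actions of the critic error, hence bounded by [delta]. *)
pose gap x := barA T pi tpi x - barAw Qw pi tpi x.
have gapE x : exp_act pi (fun x a => Aval T tpi x a - adv Qw tpi x a) x = gap x.
  by rewrite /exp_act (RintegralB measurableT (A_pi x) (Aw_pi x)).
have mgap : measurable_fun setT gap by exact: measurable_funB.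
have gapP x : `|gap x| <= delta.
  rewrite -gapE.
  apply: (norm_Rintegral_le (ker_at pi x)).
    by apply/measurable_EFinP; exact: measurable_int (integrableB measurableT (A_pi x) (Aw_pi x)).
  by move=> a; apply: (ub_le_sup delta_fin); exists (x, a).
(* Boundedness extends integrability to the visitation measure of every policy, as the comparisons
   require. *)
have rA mu : (rho T mu).-integrable setT (EFin \o barA T pi tpi).
  exact: bounded_rho_integrable zetaP mu.
have rAw mu : (rho T mu).-integrable setT (EFin \o barAw Qw pi tpi).
  exact: bounded_rho_integrable epsP mu.
have PDL := performance_difference J_pi J_tpi Q_tpi V_tpi A_pi rho_pi_V (rA pi).
have expB : exp_rho T tpi gap =
    exp_rho T tpi (barA T pi tpi) - exp_rho T tpi (barAw Qw pi tpi).
  exact: (RintegralB measurableT (rA tpi) (rAw tpi)).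
have gap_le : `|nu * exp_rho T tpi gap| <= nu * delta / (1 - gamma).
  rewrite normrM ger0_norm// -mulrA ler_wpM2l//.
  exact: norm_exp_rho_le.
have G1P := exp_rho_gap_le_kl T pi tpi mA zetaP.
have G2P := exp_rho_gap_le_kl T tpi beta mAw epsP.
have gapCV : exp_rho T tpi
    (exp_act pi (fun x a => Aval T tpi x a - adv Qw tpi x a)) =
    exp_rho T tpi gap.
  by congr (exp_rho T tpi _); exact/funext.
(* Both errors share the critic term and the shift from [pi] to [tpi]. The shift from [tpi] to
   [beta] has the weight of the off-policy term: [nu] in the first objective, [1] in the second. *)
have decomp (j jt xp xa xw xb xg xcv : R) :
    j - jt = xp -> xg = xa - xw -> xcv = xg ->
    j - (jt + (1 - nu) * xa + nu * xb) =
      nu * xg + (nu * (xw - xb) + (xp - xa)) /\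
    j - (jt + (1 - nu) * xcv + xb) = nu * xg + (1 * (xw - xb) + (xp - xa)).
  by move=> <- -> ->; split; ring.
have [E1 E2] := decomp _ _ _ _ _ (exp_rho T beta (barAw Qw pi tpi)) _ _
  PDL expB gapCV.
split.
  rewrite -[J T pi - Jtilde T Qw beta nu pi tpi]/(_ - (_ + (1 - nu) * _ + nu * _)).
  rewrite [X in (`|X|%:E <= _)%E]E1.
  exact: (combine_error_bounds c0 nu_ge0 eps0 zeta0 gap_le G1P G2P).
rewrite -[J T pi - JtildeCV T Qw beta nu pi tpi]/(_ - (_ + (1 - nu) * _ + _)).
rewrite [X in (`|X|%:E <= _)%E]E2.
have := combine_error_bounds c0 ler01 eps0 zeta0 gap_le G1P G2P.
by rewrite (mul1r eps).
Qed.
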